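(* Let $k$ be a field with a non-archimedean valuation $\nu:k\to\mathbb{T}$ and let $X$ be an integral scheme over $k$. Then the set-theoretic tropicalization of $X$ with respect to the universal embedding $X\hookrightarrow\widehat{X}$ is canonically identified with the underlying set of the Berkovich analytification $X^{\mathrm{an}}$. Moreover, this identification becomes a homeomorphism when the tropicalization of $X$, which is the set of $\mathbb{T}$-points of the scheme-theoretic tropicalization $\mathrm{Trop}_{univ}(X)$, is endowed with the strong Zariski topology, in which the closed subsets are the sets $Z(\mathbb{T})$ for $Z$ a closed subscheme of $\mathrm{Trop}_{univ}(X)$.
   Context: All monoids, rings and semirings are commutative with multiplicative unit; semirings have an additive unit. $\mathbb{T}=(\mathbb{R}\cup\{\infty\},\min,+)$ is the tropical semiring: its addition is $\min$ with $0_{\mathbb{T}}=\infty$, its multiplication is $+$ with $1_{\mathbb{T}}=0$. Semivaluations. For a ring $R$ and an idempotent semiring $S$, a semivaluation $\nu:R\to S$ is a map with $\nu(0)=0_S$, $\nu(1)=\nu(-1)=1_S$, $\nu(ab)=\nu(a)\nu(b)$ and $\nu(a+b)+\nu(a)+\nu(b)=\nu(a)+\nu(b)$. A non-archimedean valuation on the field $k$ is a semivaluation $\nu:k\to\mathbb{T}$. If $A$ is a $k$-algebra, a semivaluation $w:A\to\mathbb{T}$ is compatible with $\nu$ if $w$ restricted along $k\to A$ equals $\nu$. Analytification. The underlying set of $X^{\mathrm{an}}$ is the colimit, over the poset of affine open subschemes $U=\mathrm{Spec}\,A$ of $X$, of the sets of semivaluations $A\to\mathbb{T}$ compatible with $\nu$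 (for $U'=\mathrm{Spec}\,A'\subset U=\mathrm{Spec}\,A$, a semivaluation on $A'$ maps to its composite with $A\to A'$). For $U=\mathrm{Spec}\,A$ affine, $U^{\mathrm{an}}$ has the coarsest topology for which all maps $w\mapsto w(a)\in\mathbb{T}$, $a\in A$, are continuous, where $\mathbb{T}$ is topologized by the bijection $x\mapsto e^{-x}$ with $\mathbb{R}_{\ge 0}$; in general $X^{\mathrm{an}}$ is topologized by gluing the open subsets $U^{\mathrm{an}}$. $\mathbb{F}_1$-algebras and schemes. An $\mathbb{F}_1$-algebra is a commutative monoid-with-zero $B$; homomorphisms are monoid homomorphisms preserving $0$; $B$ is integral if its nonzero elements form a cancellative monoid. For a (semi)ring $R$, $B\otimes_{\mathbb{F}_1}R$ is the $R$-algebra generated by symbols $x_b$ ($b\in B$) with $x_ax_b=x_{ab}$, $x_1=1$, $x_0=0$ (so it is free as an $R$-module on $\{x_b: b\neq 0\}$). For an $R$-algebra $A$, $M(A)$ is its underlying multiplicative monoid-with-zero. Affine $\mathbb{F}_1$-schemes are the opposite category of $\mathbb{F}_1$-algebras and general ones are glued along open immersions (locally given by localizations); schemes over a semiring are built in the same way. Base change $Y\times_{\mathbb{F}_1}\mathrm{Spec}\,R$ is locally $\mathrm{Spec}(B\otimes_{\mathbb{F}_1}R)$. Universal embedding. For a $k$-algebra $A$ let $\widehat{A}=M(A)\otimes_{\mathbb{F}_1}k$ and $ev:\widehat{A}\to A$, $x_a\mapsto a$. If $X=\mathrm{Spec}\,A$, then $\widehat{X}=\mathrm{Spec}\,\widehat{A}$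 and $X\hookrightarrow\widehat{X}$ is the closed embedding given by $ev$. For general $X$, $\widehat{X}$ is the colimit of the $\widehat{U}$ (with $\mathbb{F}_1$-model the corresponding colimit of the $\mathrm{Spec}\,M(A)$) as $U=\mathrm{Spec}\,A$ runs over the poset of all affine open subschemes of $X$, and $X\hookrightarrow\widehat{X}$ is glued from the maps $U\hookrightarrow\widehat{U}\to\widehat X$. Tropicalization. Let $Y$ be an $\mathbb{F}_1$-scheme locally of the form $\mathrm{Spec}\,B$ with $B$ integral, and $X\hookrightarrow Y\times_{\mathbb{F}_1}\mathrm{Spec}\,k$ a closed embedding given locally by an ideal $I\subset B\otimes_{\mathbb{F}_1}k$. Let $\mathrm{trop}(I)\subset B\otimes_{\mathbb{F}_1}\mathbb{T}$ be the ideal generated by the elements $\nu(f)=\sum\nu(\lambda_i)x_{b_i}$ for $f=\sum\lambda_ix_{b_i}\in I$. Let $\mathcal{B}\,\mathrm{trop}(I)$ be the semiring congruence generated by the bend relations $g\sim g_{\widehat{b}}$ for $g\in\mathrm{trop}(I)$ and $b$ a monomial term of $g$, where $g_{\widehat{b}}$ is $g$ with that term deleted. The scheme-theoretic tropicalization is the $\mathbb{T}$-scheme glued from $\mathrm{Spec}(B\otimes_{\mathbb{F}_1}\mathbb{T}/\mathcal{B}\,\mathrm{trop}(I))$. The set-theoretic tropicalization is its set of $\mathbb{T}$-points: locally, the set of $\mathbb{T}$-algebra homomorphisms $q:B\otimes_{\mathbb{F}_1}\mathbb{T}\to\mathbb{T}$ such that for every $\sum\lambda_ix_{b_i}\in I$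 the minimum of $\{q(\nu(\lambda_i)x_{b_i})\}$ is $\infty$ or is attained at least twice. $\mathrm{Trop}_{univ}(X)$ denotes the scheme-theoretic tropicalization for $X\hookrightarrow\widehat{X}$. The canonical identification sends, on an affine open $U=\mathrm{Spec}\,A$ of $X$, a $\mathbb{T}$-point $q$ to the map $A\to\mathbb{T}$, $a\mapsto q(x_a)$. Closed subschemes of a scheme over a semiring are those defined by quasi-coherent congruence sheaves (locally, quotients of the coordinate semiring by a congruence). *)

(* Defs.v *)
From HB Require Import structures.
From Stdlib Require Import Relation_Operators.
From mathcomp Require Import all_boot all_order all_algebra finmap.
From mathcomp Require Import generic_quotient.
From mathcomp Require Import all_classical all_reals all_analysis.

Set Implicit Arguments.
Unset Strict Implicit.
Unset Printing Implicit Defensive.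

Import Order.TTheory GRing.Theory Num.Theory.
Import numFieldNormedType.Exports.

Local Open Scope classical_set_scope.
Local Open Scope ring_scope.
Local Open Scope quotient_scope.

(* Rings and semirings may be trivial ([comPzRingType], [comPzSemiRingType]):
   sections over the empty open set form the zero ring. *)

(* [None] is the element oo. *)
Definition trop (R : realType) : Type := option R.
HB.instance Definition _ (R : realType) := Choice.on (trop R).

Section Trop.
Variable R : realType.
Implicit Types x y z : trop R.

Definition tadd x y : trop R :=
  match x, y with
  | Some a, Some b => Some (Num.min a b)
  | Some a, None => Some a
  | None, _ => y
  end.

Definition tmul x y : trop R :=
  if x is Some a then if y is Some b then Some (a + b) else None else None.

Fact taddA : associative tadd.
Proof. by move=> [a|] [b|] [c|] //=; rewrite minA. Qed.
Fact taddC : commutative tadd.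
Proof. by move=> [a|] [b|] //=; rewrite minC. Qed.
Fact tadd0 : left_id None tadd. Proof. by []. Qed.
Fact tmulA : associative tmul.
Proof. by move=> [a|] [b|] [c|] //=; rewrite addrA. Qed.
Fact tmulC : commutative tmul.
Proof. by move=> [a|] [b|] //=; rewrite addrC. Qed.
Fact tmul1 : left_id (Some 0) tmul.
Proof. by move=> [a|] //=; rewrite add0r. Qed.
Fact tmulDl : left_distributive tmul tadd.
Proof. by move=> [a|] [b|] [c|] //=; rewrite addr_minl. Qed.
Fact tmul0 : left_zero None tmul. Proof. by []. Qed.

HB.instance Definition _ := GRing.isNmodule.Build (trop R) taddA taddC tadd0.
HB.instance Definition _ :=
  GRing.Nmodule_isComPzSemiRing.Build (trop R) tmulA tmulC tmul1 tmulDl tmul0.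

Definition expN x : R := if x is Some a then expR (- a) else 0.

(* [expN] is a bijection onto the nonnegative reals, so that the initial
   topology is the one transported from there. *)
HB.instance Definition _ :=
  Topological.copy (trop R) (initial_topology expN).

End Trop.

Definition semivaluation (A : comPzRingType) (S : comPzSemiRingType)
    (v : A -> S) : Prop :=
  [/\ v 0 = 0, v 1 = 1 /\ v (- 1) = 1,
      (forall a b, v (a * b) = v a * v b)
    & (forall a b, v (a + b) + v a + v b = v a + v b)].

Definition prime_ideal (A : comPzRingType) (p : set A) : Prop :=
  [/\ p 0, (forall a b, p a -> p b -> p (a + b)), (forall a b, p b -> p (a * b)),
      ~ p 1 & (forall a b, p (a * b) -> p a \/ p b)].

(* [h] exhibits [B] as the localization of [A] at the powers of [f]. *)
Definition localization_at (A B : comPzSemiRingType) (f : A) (h : A -> B) :=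
  [/\ (exists u, u * h f = 1),
      (forall b, exists a n, b * h f ^+ n = h a)
    & (forall a a', h a = h a' -> exists n, f ^+ n * a = f ^+ n * a')].

Definition opens (X : topologicalType) := {U : set X | open U}.
Definition opens_set (X : topologicalType) (U : opens X) : set X := sval U.
Coercion opens_set : opens >-> set.

Definition opens_full (X : topologicalType) : opens X := exist _ setT openT.

Record ringed_space := RingedSpace {
  pts : topologicalType;
  sec : opens pts -> comPzRingType;
  res : forall U V : opens pts, V `<=` U -> {rmorphism sec U -> sec V};
  res_id : forall (U : opens pts) (h : U `<=` U) s, res h s = s;
  res_comp : forall (U V W : opens pts)
    (h : V `<=` U) (h' : W `<=` V) (h'' : W `<=` U) s,
    res h' (res h s) = res h'' s;
  sheaf_separated : forall (I : Type) (U : opens pts) (V : I -> opens pts)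
    (h : forall i, V i `<=` U), U `<=` \bigcup_i V i ->
    forall s t, (forall i, res (h i) s = res (h i) t) -> s = t;
  sheaf_glue : forall (I : Type) (U : opens pts) (V : I -> opens pts)
    (h : forall i, V i `<=` U), U `<=` \bigcup_i V i ->
    forall s : forall i, sec (V i),
      (forall i j (W : opens pts) (hi : W `<=` V i) (hj : W `<=` V j),
         res hi (s i) = res hj (s j)) ->
      exists t, forall i, res (h i) t = s i }.

Arguments res {r U V}.

(* [U] is isomorphic to Spec A for A the ring of sections over [U]: [phi] is a
   homeomorphism onto the set of prime ideals with the Zariski topology, and
   the sections over the principal open D(f) are the localization A_f (which
   determines the structure sheaf since the D(f) form a base). *)
Definition affine (X : ringed_space) (U : opens (pts X)) : Prop :=
  exists phi : pts X -> set (sec U),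
  [/\ set_bij U (@prime_ideal (sec U)) phi,
      (forall V : set (pts X), V `<=` U ->
        (open V <-> exists E : set (sec U),
          V = [set x | opens_set U x /\ exists2 f, E f & ~ phi x f]))
    & (forall (f : sec U) (V : opens (pts X)) (h : V `<=` U),
        opens_set V = [set x | opens_set U x /\ ~ phi x f] ->
        localization_at f (res h))].

(* A scheme over k; the structure map to Spec k is given by a ring
   homomorphism from k to the global sections. *)
Record scheme (k : fieldType) := Scheme {
  space :> ringed_space;
  locally_affine : forall x : pts space,
    exists U : opens (pts space), affine U /\ opens_set U x;
  kmap : {rmorphism k -> sec (opens_full (pts space))} }.

Definition integral_domain (A : comPzRingType) : Prop :=
  (1 : A) <> 0 /\ forall a b : A, a * b = 0 -> a = 0 \/ b = 0.

Definition integral_scheme (X : ringed_space) : Prop :=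
  [set: pts X] !=set0 /\
  forall U : opens (pts X), opens_set U !=set0 -> integral_domain (sec U).

Section AffineOpens.
Variables (k : fieldType) (X : scheme k).

Definition affine_open := {U : opens (pts X) | affine U}.
Definition affine_opens (U : affine_open) : opens (pts X) := sval U.
Coercion affine_opens : affine_open >-> opens.

Definition kinj (U : affine_open) (c : k) : sec U :=
  res (U := opens_full (pts X)) (@subsetT _ U) (kmap X c).

End AffineOpens.

Definition quo (A : Type) (r : A -> A -> Prop) : Type :=
  {C : set A | exists a, C = [set b | clos_refl_sym_trans A r a b]}.

Definition cls (A : Type) (r : A -> A -> Prop) (a : A) : quo r :=
  exist _ [set b | clos_refl_sym_trans A r a b] (ex_intro _ a erefl).

Section Analytification.
Variables (R : realType) (k : fieldType) (nu : k -> trop R) (X : scheme k).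

Definition berkovich_affine (U : affine_open X) : Type :=
  {w : sec U -> trop R | semivaluation w /\ forall c, w (kinj U c) = nu c}.

HB.instance Definition _ U := gen_eqMixin (berkovich_affine U).
HB.instance Definition _ U := gen_choiceMixin (berkovich_affine U).

HB.instance Definition _ (U : affine_open X) :=
  Topological.copy (berkovich_affine U)
    (sup_topology (fun a : sec U => Topological.class
       (initial_topology (fun w : berkovich_affine U => sval w a)))).

Definition berkovich_pre : Type := {U : affine_open X & berkovich_affine U}.

Definition berkovich_step (p q : berkovich_pre) : Prop :=
  exists h : tag p `<=` tag q,
    forall a, sval (tagged q) a = sval (tagged p) (res h a).

(* The colimit of the sets [berkovich_affine U]; it carries the final topology,
   which is the one glued from the open pieces. *)
Definition berkovich : Type := quo berkovich_step.

Definition berkovich_class (U : affine_open X) (w : berkovich_affine U) : berkovich :=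
  cls berkovich_step (existT berkovich_affine U w).

HB.instance Definition _ := gen_eqMixin berkovich.
HB.instance Definition _ := gen_choiceMixin berkovich.

Definition berkovich_op : set_system berkovich :=
  [set W | forall U : affine_open X, open ((@berkovich_class U) @^-1` W)].

Fact berkovich_opT : berkovich_op setT.
Proof. by move=> U; exact: openT. Qed.
Fact berkovich_opI : setI_closed berkovich_op.
Proof. by move=> A B hA hB U; exact: (openI (hA U) (hB U)). Qed.
Fact berkovich_op_bigU (I : Type) (f : I -> set berkovich) :
  (forall i, berkovich_op (f i)) -> berkovich_op (\bigcup_i f i).
Proof. by move=> hf U; rewrite preimage_bigcup; apply: bigcup_open => i _; exact: hf. Qed.

HB.instance Definition _ :=
  isOpenTopological.Build berkovich berkovich_opT berkovich_opI berkovich_op_bigU.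

End Analytification.

Record f1alg := F1Alg {
  f1car :> choiceType;
  f1mul : f1car -> f1car -> f1car;
  f1one : f1car;
  f1zero : f1car;
  f1mulA : associative f1mul;
  f1mulC : commutative f1mul;
  f1mul1 : left_id f1one f1mul;
  f1mul0 : left_zero f1zero f1mul }.

Definition mulmon (A : comPzRingType) : f1alg :=
  F1Alg (@mulrA A) (@mulrC A) (@mul1r A) (@mul0r A).

Record f1hom (B B' : f1alg) := F1Hom {
  f1fun :> B -> B';
  f1homM : forall a b, f1fun (f1mul a b) = f1mul (f1fun a) (f1fun b);
  f1hom1 : f1fun (f1one B) = f1one B';
  f1hom0 : f1fun (f1zero B) = f1zero B' }.

Record alg (R : comPzSemiRingType) := Alg {
  alg_car :> comPzSemiRingType;
  alg_str : {rmorphism R -> alg_car} }.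

Record alghom (R : comPzSemiRingType) (A A' : alg R) := AlgHom {
  alg_fun :> {rmorphism A -> A'};
  alg_funE : forall c, alg_fun (alg_str A c) = alg_str A' c }.

Definition alg_self (R : comPzSemiRingType) : alg R :=
  @Alg R R (idfun : {rmorphism R -> R}).

(* The free [R]-module on the nonzero elements of [B]: finitely supported
   functions vanishing at 0. *)
Section Tensor.
Variables (B : f1alg) (R : comPzSemiRingType).

Record tensor : Type := Tensor {
  coef : {fsfun B -> R with 0};
  coef_zero : coef (f1zero B) == 0 }.
HB.instance Definition _ := [isSub for coef].
HB.instance Definition _ := [Choice of tensor by <:].

Definition mkten_fun (S : {fset B}) (h : B -> R) : {fsfun B -> R with 0} :=
  [fsfun x in S => if x == f1zero B then 0 else h x | 0].

Fact mkten_proof S h : mkten_fun S h (f1zero B) == 0.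
Proof. by rewrite fsfunE eqxx if_same. Qed.

Definition mkten S h : tensor := Tensor (mkten_proof S h).

Lemma mktenE S h x :
  coef (mkten S h) x = if (x \in S) && (x != f1zero B) then h x else 0.
Proof. by rewrite fsfunE; case: (x \in S); case: eqP. Qed.

Lemma coef0 f : coef f (f1zero B) = 0.
Proof. exact/eqP/coef_zero. Qed.

Lemma tensorP (f g : tensor) : coef f =1 coef g <-> f = g.
Proof.
by split=> [h|-> //]; apply/val_inj/fsfunP.
Qed.

Definition ten0 : tensor := mkten fset0 (fun=> 0).
Definition tenadd (f g : tensor) : tensor :=
  mkten (finsupp (coef f) `|` finsupp (coef g))%fset
    (fun x => coef f x + coef g x).

(* The term c x_b. *)
Definition mon (c : R) (b : B) : tensor := mkten [fset b]%fset (fun=> c).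

Lemma tenaddE f g x : coef (tenadd f g) x = coef f x + coef g x.
Proof.
rewrite mktenE in_fsetU; case: eqP => [->|_].
  by rewrite andbF !coef0 addr0.
by rewrite andbT; do 2 case: finsuppP => _ //=; rewrite addr0.
Qed.

Lemma ten0E x : coef ten0 x = 0.
Proof. by rewrite mktenE. Qed.

Fact tenaddA : associative tenadd.
Proof. by move=> f g h; apply/tensorP => x; rewrite !tenaddE addrA. Qed.
Fact tenaddC : commutative tenadd.
Proof. by move=> f g; apply/tensorP => x; rewrite !tenaddE addrC. Qed.
Fact tenadd0 : left_id ten0 tenadd.
Proof. by move=> f; apply/tensorP => x; rewrite tenaddE ten0E add0r. Qed.
HB.instance Definition _ := GRing.isNmodule.Build tensor
  tenaddA tenaddC tenadd0.

Lemma coefD f g x : coef (f + g) x = coef f x + coef g x.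
Proof. exact: tenaddE. Qed.

Lemma coefZ0 x : coef (0 : tensor) x = 0.
Proof. exact: ten0E. Qed.

Lemma coef_sum (I : Type) (r : seq I) (F : I -> tensor) x :
  coef (\sum_(i <- r) F i) x = \sum_(i <- r) coef (F i) x.
Proof.
by elim/big_ind2: _ => [|u u' v v' <- <-|//]; rewrite ?coefZ0 ?coefD.
Qed.

Lemma monE c b x :
  coef (mon c b) x = if (x == b) && (x != f1zero B) then c else 0.
Proof. by rewrite mktenE in_fset1. Qed.

Lemma mon0 b : mon 0 b = 0.
Proof. by apply/tensorP => x; rewrite monE if_same coefZ0. Qed.

Lemma monD b c d : mon (c + d) b = mon c b + mon d b.
Proof.
by apply/tensorP => x; rewrite coefD !monE; case: ifP => // _; rewrite addr0.
Qed.

Lemma mon_zero c : mon c (f1zero B) = 0.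
Proof.
by apply/tensorP => x; rewrite monE coefZ0; case: eqP.
Qed.

(* [term_sum F f] is the sum of the [F b c] over the terms c x_b of [f]. *)
Definition term_sum (V : nmodType) (F : B -> R -> V) (f : tensor) : V :=
  \sum_(b <- finsupp (coef f)) F b (coef f b).

Lemma term_sum_sup (V : nmodType) (F : B -> R -> V) (f : tensor) (S : {fset B}) :
  (finsupp (coef f) `<=` S)%fset -> (forall b, F b 0 = 0) ->
  term_sum F f = \sum_(b <- S) F b (coef f b).
Proof.
move=> fS F0; rewrite /term_sum; apply: big_fset_incl => // b _ bf.
by rewrite fsfun_dflt.
Qed.

Lemma term_sumD (V : nmodType) (F : B -> R -> V) :
  (forall b, F b 0 = 0) -> (forall b c d, F b (c + d) = F b c + F b d) ->
  {morph term_sum F : f g / f + g}.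
Proof.
move=> F0 FD f g.
pose S := (finsupp (coef f) `|` finsupp (coef g) `|` finsupp (coef (f + g)%R))%fset.
rewrite !(@term_sum_sup _ _ _ S) //; last 3 first.
- by apply: fsubset_trans (fsubsetUl _ _); exact: fsubsetUr.
- by apply: fsubset_trans (fsubsetUl _ _); exact: fsubsetUl.
- exact: fsubsetUr.
by rewrite -big_split /=; apply: eq_bigr => b _; rewrite coefD FD.
Qed.

Lemma term_sum0 (V : nmodType) (F : B -> R -> V) : term_sum F 0 = 0.
Proof.
rewrite /term_sum big_seq big1 // => b; rewrite mem_finsupp.
by rewrite coefZ0 eqxx.
Qed.

Lemma term_sum_eq0 (V : nmodType) (F : B -> R -> V) f :
  (forall b c, F b c = 0) -> term_sum F f = 0.
Proof. by move=> F0; rewrite /term_sum big1. Qed.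

Lemma eq_term_sum (V : nmodType) (F G : B -> R -> V) f :
  (forall b c, F b c = G b c) -> term_sum F f = term_sum G f.
Proof. by move=> FG; apply: eq_bigr => b _. Qed.

Lemma term_sum_split (V : nmodType) (F G : B -> R -> V) f :
  term_sum (fun b c => F b c + G b c) f = term_sum F f + term_sum G f.
Proof. exact: big_split. Qed.

Lemma term_sum_mon (V : nmodType) (F : B -> R -> V) c b :
  (forall b, F b 0 = 0) -> F (f1zero B) c = 0 -> term_sum F (mon c b) = F b c.
Proof.
move=> F0 Fz; rewrite (@term_sum_sup _ _ _ [fset b]%fset) //; last first.
  apply/fsubsetP => x; rewrite mem_finsupp monE in_fset1.
  by case: (x == b) => //=; rewrite eqxx.
rewrite big_seq_fset1 monE eqxx /=; case: eqP => //= ->.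
by rewrite F0 Fz.
Qed.

Lemma term_sum_id f : term_sum (fun b c => mon c b) f = f.
Proof.
apply/tensorP => x; rewrite /term_sum coef_sum.
have [xf|xf] := boolP (x \in finsupp (coef f)).
  rewrite (big_fsetD1 x) //= monE eqxx /=.
  rewrite big_seq big1 ?addr0; last first.
    by move=> b; rewrite in_fsetD1 eq_sym monE => /andP[/negPf-> _].
  by case: eqP => //= ->; rewrite coef0.
rewrite fsfun_dflt // big_seq big1 // => b bf; rewrite monE.
by case: eqP => //= xb; rewrite xb bf in xf.
Qed.

Lemma tensor_ind (P : tensor -> Prop) :
  P 0 -> (forall f g, P f -> P g -> P (f + g)) -> (forall c b, P (mon c b)) ->
  forall f, P f.
Proof.
by move=> P0 PD Pm f; rewrite -(term_sum_id f); apply: big_ind => // b _.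
Qed.

Definition ten1 : tensor := mon 1 (f1one B).
Definition tenmul (f g : tensor) : tensor :=
  term_sum (fun a c => term_sum (fun b d => mon (c * d) (f1mul a b)) g) f.

Fact tenmulDl : left_distributive tenmul +%R.
Proof.
move=> f g h; apply: term_sumD => [a|a c d] /=.
  by apply: term_sum_eq0 => b e; rewrite mul0r mon0.
by rewrite -term_sum_split; apply: eq_term_sum => b e; rewrite mulrDl monD.
Qed.

Fact tenmulC : commutative tenmul.
Proof.
move=> f g; rewrite /tenmul /term_sum exchange_big; apply: eq_bigr => b _.
by apply: eq_bigr => a _; rewrite mulrC f1mulC.
Qed.

Fact tenmul0 : left_zero 0 tenmul.
Proof. by move=> f; exact: term_sum0. Qed.

Fact tenmulDr : right_distributive tenmul +%R.
Proof. by move=> f g h; rewrite !(tenmulC f) tenmulDl. Qed.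

Fact tenmul_mon c a d b : tenmul (mon c a) (mon d b) = mon (c * d) (f1mul a b).
Proof.
have E e a' : term_sum (fun b d => mon (e * d) (f1mul a' b)) (mon d b) =
    mon (e * d) (f1mul a' b).
  apply: term_sum_mon => [b'|]; first by rewrite mulr0 mon0.
  by rewrite f1mulC f1mul0 mon_zero.
rewrite /tenmul -E; apply: term_sum_mon => [a'|].
  by apply: term_sum_eq0 => i e; rewrite mul0r mon0.
by apply: term_sum_eq0 => i e; rewrite f1mul0 mon_zero.
Qed.

Fact tenmulA : associative tenmul.
Proof.
move=> f g h; elim/tensor_ind: f => [|f f' Hf Hf'|c a].
- by rewrite !tenmul0.
- by rewrite !tenmulDl Hf Hf'.
elim/tensor_ind: g => [|g g' Hg Hg'|d b].
- by rewrite !(tenmul0, tenmulC _ 0).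
- by rewrite !(tenmulDl, tenmulDr) Hg Hg'.
elim/tensor_ind: h => [|h h' Hh Hh'|e b'].
- by rewrite !(tenmulC _ 0) !tenmul0 tenmulC tenmul0.
- by rewrite !tenmulDr Hh Hh'.
by rewrite !tenmul_mon mulrA f1mulA.
Qed.

Fact tenmul1 : left_id ten1 tenmul.
Proof.
move=> f; elim/tensor_ind: f => [|f f' Hf Hf'|c a].
- by rewrite tenmulC tenmul0.
- by rewrite tenmulDr Hf Hf'.
by rewrite tenmul_mon mul1r f1mul1.
Qed.

HB.instance Definition _ := GRing.Nmodule_isComPzSemiRing.Build tensor
  tenmulA tenmulC tenmul1 tenmulDl tenmul0.

Definition ten_cst (c : R) : tensor := mon c (f1one B).

Fact ten_cst_nmod : nmod_morphism ten_cst.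
Proof. by split=> [|c d]; [exact: mon0|exact: monD]. Qed.
Fact ten_cst_monoid : monoid_morphism ten_cst.
Proof. by split=> // c d; rewrite /ten_cst [RHS]tenmul_mon f1mul1. Qed.
HB.instance Definition _ := GRing.isNmodMorphism.Build R tensor ten_cst
  ten_cst_nmod.
HB.instance Definition _ := GRing.isMonoidMorphism.Build R tensor ten_cst
  ten_cst_monoid.

Definition tensor_alg : alg R := @Alg R tensor ten_cst.

Lemma mulmon_mon c a d b : mon c a * mon d b = mon (c * d) (f1mul a b).
Proof. exact: tenmul_mon. Qed.

End Tensor.

Section TensorMap.
Variables (R : comPzSemiRingType).

Definition tmap (B B' : f1alg) (phi : f1hom B B') (f : tensor B R) :
    tensor B' R :=
  term_sum (fun b c => mon c (phi b)) f.

Section Morphism.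
Variables (B B' : f1alg) (phi : f1hom B B').

Lemma tmap_mon c b : tmap phi (mon c b) = mon c (phi b).
Proof.
by apply: term_sum_mon => [b'|]; [exact: mon0|rewrite f1hom0 mon_zero].
Qed.

Fact tmap_nmod : nmod_morphism (tmap phi).
Proof.
by split=> [|f g]; [exact: term_sum0|apply: term_sumD => *; [exact: mon0|exact: monD]].
Qed.
HB.instance Definition _ := GRing.isNmodMorphism.Build _ _ (tmap phi) tmap_nmod.

Fact tmap_monoid : monoid_morphism (tmap phi).
Proof.
split=> [|f g]; first by rewrite [LHS]tmap_mon f1hom1.
elim/tensor_ind: f => [|f f' Hf Hf'|c a].
- by rewrite !(mul0r, raddf0).
- by rewrite mulrDl !raddfD /= Hf Hf' mulrDl.
elim/tensor_ind: g => [|g g' Hg Hg'|d b].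
- by rewrite !(mulr0, raddf0).
- by rewrite mulrDr !raddfD /= Hg Hg' mulrDr.
by rewrite mulmon_mon !tmap_mon mulmon_mon f1homM.
Qed.
HB.instance Definition _ :=
  GRing.isMonoidMorphism.Build _ _ (tmap phi) tmap_monoid.

Fact tmap_cst c : tmap phi (ten_cst B c) = ten_cst B' c.
Proof. by rewrite [LHS]tmap_mon f1hom1. Qed.

Lemma tmap_coef f b : injective phi -> coef (tmap phi f) (phi b) = coef f b.
Proof.
move=> phiI; elim/tensor_ind: f => [|f f' Hf Hf'|c a].
- by rewrite raddf0 !coefZ0.
- by rewrite raddfD /= !coefD Hf Hf'.
by rewrite tmap_mon !monE (inj_eq phiI) -(f1hom0 phi) (inj_eq phiI).
Qed.

Lemma tmap_coefN f b' : (forall b, phi b <> b') -> coef (tmap phi f) b' = 0.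
Proof.
move=> hb; elim/tensor_ind: f => [|f f' Hf Hf'|c a].
- by rewrite raddf0 coefZ0.
- by rewrite raddfD /= coefD Hf Hf' addr0.
by rewrite tmap_mon monE; case: eqP => // /esym/hb.
Qed.

End Morphism.

Lemma tmap_id (B : f1alg) (phi : f1hom B B) f : phi =1 id -> tmap phi f = f.
Proof.
move=> h; rewrite -[RHS]term_sum_id; apply: eq_bigr => b _; by rewrite h.
Qed.

Lemma tmap_comp (B B' B'' : f1alg) (phi : f1hom B B') (psi : f1hom B' B'')
  (chi : f1hom B B'') f : (forall b, psi (phi b) = chi b) ->
  tmap psi (tmap phi f) = tmap chi f.
Proof.
move=> h; elim/tensor_ind: f => [|f f' Hf Hf'|c a].
- by rewrite !raddf0.
- by rewrite !raddfD /= Hf Hf'.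
by rewrite !tmap_mon h.
Qed.

End TensorMap.

Record congruence (S : comPzSemiRingType) := Congruence {
  cong :> S -> S -> Prop;
  cong_refl : forall a, cong a a;
  cong_sym : forall a b, cong a b -> cong b a;
  cong_trans : forall b a c, cong a b -> cong b c -> cong a c;
  congD : forall a b c d, cong a b -> cong c d -> cong (a + c) (b + d);
  congM : forall a b c d, cong a b -> cong c d -> cong (a * c) (b * d) }.

Section Generated.
Variables (S : comPzSemiRingType) (r : S -> S -> Prop).

Definition gen_rel (a b : S) : Prop :=
  forall E : congruence S, (forall x y, r x y -> E x y) -> E a b.

Fact gen_refl a : gen_rel a a.
Proof. by move=> E _; exact: cong_refl. Qed.
Fact gen_sym a b : gen_rel a b -> gen_rel b a.
Proof. by move=> h E hE; apply/cong_sym/h. Qed.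
Fact gen_trans b a c : gen_rel a b -> gen_rel b c -> gen_rel a c.
Proof. by move=> h h' E hE; apply: (cong_trans (h E hE)); apply: h'. Qed.
Fact genD a b c d : gen_rel a b -> gen_rel c d -> gen_rel (a + c) (b + d).
Proof. by move=> h h' E hE; apply: congD; [apply: h|apply: h']. Qed.
Fact genM a b c d : gen_rel a b -> gen_rel c d -> gen_rel (a * c) (b * d).
Proof. by move=> h h' E hE; apply: congM; [apply: h|apply: h']. Qed.

Definition cong_gen : congruence S :=
  Congruence gen_refl gen_sym gen_trans genD genM.

End Generated.

Section Quotient.
Variables (R : comPzSemiRingType) (A : alg R) (E : congruence A).

Definition brel : rel A := fun a b => `[< E a b >].

Fact brel_refl : reflexive brel.
Proof. by move=> a; apply/asboolP/cong_refl. Qed.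
Fact brel_sym : symmetric brel.
Proof. by move=> a b; apply/asboolP/asboolP => /cong_sym. Qed.
Fact brel_trans : transitive brel.
Proof.
by move=> b a c /asboolP h /asboolP h'; apply/asboolP/(cong_trans h h').
Qed.
Canonical brel_equiv := EquivRel brel brel_refl brel_sym brel_trans.

Definition squot : Type := {eq_quot brel_equiv}.
HB.instance Definition _ := Choice.on squot.

Definition spi (a : A) : squot := \pi_{eq_quot brel_equiv} a.
Definition srepr (x : squot) : A := repr (x : {eq_quot brel_equiv}).

Lemma sreprK : cancel srepr spi.
Proof. exact: reprK. Qed.

Lemma spiP a b : spi a = spi b <-> E a b.
Proof.
by split=> [/eqmodP/asboolP//|h]; apply/eqmodP/asboolP.
Qed.

Lemma srepr_spi a : E (srepr (spi a)) a.
Proof. by apply/spiP; rewrite sreprK. Qed.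

Definition sqadd x y := spi (srepr x + srepr y).
Definition sqmul x y := spi (srepr x * srepr y).

Lemma sqaddE a b : sqadd (spi a) (spi b) = spi (a + b).
Proof. by apply/spiP/congD; exact: srepr_spi. Qed.
Lemma sqmulE a b : sqmul (spi a) (spi b) = spi (a * b).
Proof. by apply/spiP/congM; exact: srepr_spi. Qed.

Fact sqaddA : associative sqadd.
Proof.
move=> x y z; rewrite -(sreprK x) -(sreprK y) -(sreprK z).
by rewrite !sqaddE addrA.
Qed.
Fact sqaddC : commutative sqadd.
Proof. by move=> x y; rewrite /sqadd addrC. Qed.
Fact sqadd0 : left_id (spi 0) sqadd.
Proof. by move=> x; rewrite -(sreprK x) sqaddE add0r. Qed.
HB.instance Definition _ := GRing.isNmodule.Build squot sqaddA sqaddC sqadd0.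

Fact sqmulA : associative sqmul.
Proof.
move=> x y z; rewrite -(sreprK x) -(sreprK y) -(sreprK z).
by rewrite !sqmulE mulrA.
Qed.
Fact sqmulC : commutative sqmul.
Proof. by move=> x y; rewrite /sqmul mulrC. Qed.
Fact sqmul1 : left_id (spi 1) sqmul.
Proof. by move=> x; rewrite -(sreprK x) sqmulE mul1r. Qed.
Fact sqmulDl : left_distributive sqmul +%R.
Proof.
move=> x y z; rewrite -(sreprK x) -(sreprK y) -(sreprK z).
by rewrite [spi _ + spi _]sqaddE !sqmulE [RHS]sqaddE mulrDl.
Qed.
Fact sqmul0 : left_zero 0 sqmul.
Proof. by move=> x; rewrite -(sreprK x) sqmulE mul0r. Qed.
HB.instance Definition _ := GRing.Nmodule_isComPzSemiRing.Build squot
  sqmulA sqmulC sqmul1 sqmulDl sqmul0.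

Fact spi_nmod : nmod_morphism spi.
Proof. by split=> // a b; rewrite [RHS]sqaddE. Qed.
Fact spi_monoid : monoid_morphism spi.
Proof. by split=> // a b; rewrite [RHS]sqmulE. Qed.
HB.instance Definition _ := GRing.isNmodMorphism.Build A squot spi spi_nmod.
HB.instance Definition _ :=
  GRing.isMonoidMorphism.Build A squot spi spi_monoid.

Definition quot_alg : alg R := @Alg R squot (spi \o alg_str A).

Definition quot_pi : alghom A quot_alg := @AlgHom R A quot_alg spi (fun=> erefl).

End Quotient.

Section QuotientMap.
Variables (R : comPzSemiRingType) (A A' : alg R) (E : congruence A)
  (E' : congruence A') (f : alghom A A').
Hypothesis fE : forall a b, E a b -> E' (f a) (f b).

Definition quot_map_fun (x : quot_alg E) : quot_alg E' :=
  quot_pi E' (f (srepr x)).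

Lemma quot_map_pi a : quot_map_fun (quot_pi E a) = quot_pi E' (f a).
Proof. by apply/spiP/fE/srepr_spi. Qed.

Fact quot_map_nmod : nmod_morphism quot_map_fun.
Proof.
split=> [|x y].
  by rewrite -(rmorph0 (quot_pi E)) quot_map_pi !rmorph0.
rewrite -(sreprK x) -(sreprK y) -[spi _ _]/(quot_pi E _).
rewrite -[spi _ (srepr y)]/(quot_pi E _) -rmorphD !quot_map_pi.
by rewrite !rmorphD.
Qed.
Fact quot_map_monoid : monoid_morphism quot_map_fun.
Proof.
split=> [|x y].
  by rewrite -(rmorph1 (quot_pi E)) quot_map_pi !rmorph1.
rewrite -(sreprK x) -(sreprK y) -[spi _ _]/(quot_pi E _).
rewrite -[spi _ (srepr y)]/(quot_pi E _) -rmorphM !quot_map_pi.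
by rewrite !rmorphM.
Qed.
HB.instance Definition _ :=
  GRing.isNmodMorphism.Build _ _ quot_map_fun quot_map_nmod.
HB.instance Definition _ :=
  GRing.isMonoidMorphism.Build _ _ quot_map_fun quot_map_monoid.

Fact quot_map_str c :
  quot_map_fun (alg_str (quot_alg E) c) = alg_str (quot_alg E') c.
Proof.
by rewrite -(alg_funE (quot_pi E)) quot_map_pi -(alg_funE (quot_pi E')) alg_funE.
Qed.

Definition quot_map : alghom (quot_alg E) (quot_alg E') :=
  @AlgHom _ _ _ quot_map_fun quot_map_str.

End QuotientMap.

Section LocalTrop.
Variables (R : realType) (k : fieldType) (nu : k -> trop R) (B : f1alg).
Implicit Type I : set (tensor B k).

Definition ten_nu (f : tensor B k) : tensor B (trop R) :=
  term_sum (fun b c => mon (nu c) b) f.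

Definition is_ideal (S : comPzSemiRingType) (J : set S) : Prop :=
  [/\ J 0, (forall a b, J a -> J b -> J (a + b))
    & (forall a b, J b -> J (a * b))].

Definition trop_ideal I : set (tensor B (trop R)) :=
  [set g | forall J, is_ideal J -> (forall f, I f -> J (ten_nu f)) -> J g].

(* [g'] is [g] with one of its monomial terms deleted. *)
Definition term_deleted (g g' : tensor B (trop R)) : Prop :=
  exists2 b, b \in finsupp (coef g) &
    coef g' b = 0 /\ forall c, c != b -> coef g' c = coef g c.

Definition bend I : congruence (tensor_alg B (trop R)) :=
  cong_gen (fun g g' => trop_ideal I g /\ term_deleted g g').

Definition trop_alg I : alg (trop R) := quot_alg (bend I).

(* Sums in [trop R] are minima, and 0 is oo. *)
Definition trop_solution I (q : tensor B (trop R) -> trop R) : Prop :=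
  forall f, I f ->
  let t b := q (mon (nu (coef f b)) b) in
  let m := \sum_(b <- finsupp (coef f)) t b in
  m = 0 \/ exists b b', [/\ b \in finsupp (coef f), b' \in finsupp (coef f),
                           b != b', t b = m & t b' = m].

Definition set_trop_local I : Type :=
  {q : alghom (tensor_alg B (trop R)) (alg_self (trop R)) | trop_solution I q}.

Lemma ten_nuE f b :
  coef (ten_nu f) b = if b \in finsupp (coef f) then nu (coef f b) else 0.
Proof.
rewrite /ten_nu /term_sum coef_sum; case: ifP => bf.
  rewrite (big_fsetD1 b) //= monE eqxx /= big_seq big1 ?addr0; last first.
    by move=> c; rewrite in_fsetD1 eq_sym monE => /andP[/negPf-> _].
  by case: eqP => //= b0; move: bf; rewrite b0 mem_finsupp coef0 eqxx.
rewrite big_seq big1 // => c cf; rewrite monE.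
by case: eqP => //= bc; rewrite bc cf in bf.
Qed.

End LocalTrop.

Section LocalTropMap.
Variables (R : realType) (k : fieldType) (nu : k -> trop R) (B B' : f1alg).
Variables (phi : f1hom B B') (I : set (tensor B k)) (I' : set (tensor B' k)).

Lemma ten_nu_tmap f : injective phi ->
  ten_nu nu (tmap phi f) = tmap phi (ten_nu nu f).
Proof.
move=> phiI; apply/tensorP => b'; rewrite ten_nuE mem_finsupp.
have [[b <-]|nb] := pselect (exists b, phi b = b').
  by rewrite !tmap_coef // ten_nuE mem_finsupp.
have {}nb b : phi b <> b' by move=> hb; apply: nb; exists b.
by rewrite !tmap_coefN // eqxx.
Qed.

Hypothesis phiI : injective phi.
Hypothesis IP : forall f, I f -> I' (tmap phi f).

Lemma trop_ideal_tmap g : trop_ideal nu I g -> trop_ideal nu I' (tmap phi g).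
Proof.
move=> hg J hJ hI'; apply: (hg (fun g => J (tmap phi g))).
  case: hJ => J0 JD JM; split=> [|a b|a b]; rewrite ?rmorph0 ?rmorphD ?rmorphM.
  - exact: J0.
  - exact: JD.
  - exact: JM.
by move=> f If; rewrite -ten_nu_tmap //; apply/hI'/IP.
Qed.

Lemma term_deleted_tmap (g g' : tensor B (trop R)) :
  term_deleted g g' -> term_deleted (tmap phi g) (tmap phi g').
Proof.
move=> [b bg [g'b g'E]]; exists (phi b).
  by rewrite mem_finsupp tmap_coef // -mem_finsupp.
split=> [|c' c'b]; first by rewrite tmap_coef.
have [[c hc]|nc] := pselect (exists c, phi c = c').
  by rewrite -hc !tmap_coef //; apply: g'E; apply: contraNneq c'b => <-; apply/eqP.
have {}nc c : phi c <> c' by move=> hc; apply: nc; exists c.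
by rewrite !tmap_coefN.
Qed.

End LocalTropMap.

(* A scheme glued from affine pieces, presented by its gluing datum: a diagram
   of coordinate algebras indexed by a preordered set of charts, in which
   [cle V U] means that the chart V maps to the chart U.  Among these maps the
   principal open immersions are those given by localizations. *)
Record gscheme (R : comPzSemiRingType) := GScheme {
  chart : Type;
  cle : chart -> chart -> Prop;
  cle_refl : forall U, cle U U;
  cle_trans : forall V U W, cle W V -> cle V U -> cle W U;
  calg : chart -> alg R;
  cres : forall U V, cle V U -> alghom (calg U) (calg V);
  cres_id : forall U (h : cle U U) s, cres h s = s;
  cres_comp : forall U V W (h : cle V U) (h' : cle W V) (h'' : cle W U) s,
    cres h' (cres h s) = cres h'' s }.

Arguments cres {R g U V}.

Section GSchemePoints.
Variables (R : comPzSemiRingType) (Y : gscheme R).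

Definition point_pre : Type :=
  {U : chart Y & alghom (calg U) (alg_self R)}.

Definition point_step (p q : point_pre) : Prop :=
  exists h : cle (tag p) (tag q),
    forall s, tagged q s = tagged p (cres h s).

(* The points with values in the semiring [R] itself, for [R] a semifield: a
   morphism from the one-point scheme Spec R factors through a chart. *)
Definition points : Type := quo point_step.

Definition point_class (U : chart Y) (q : alghom (calg U) (alg_self R)) :
    points :=
  cls point_step (existT (fun U => alghom (calg U) (alg_self R)) U q).

(* A quasi-coherent congruence sheaf, given by its sections on the charts:
   [cs_res] says that it is a subpresheaf of pairs of functions, and [cs_qc]
   that on a principal open subscheme it is induced by the congruence on the
   ambient chart. *)
Record closed_subscheme := ClosedSubscheme {
  cs_cong :> forall U : chart Y, congruence (calg U);
  cs_res : forall U V (h : cle V U) s t,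
    cs_cong U s t -> cs_cong V (cres h s) (cres h t);
  cs_qc : forall U V (h : cle V U) (f : calg U), localization_at f (cres h) ->
    forall s t, cs_cong V s t ->
    cong_gen (fun x y => exists a b,
      [/\ cs_cong U a b, x = cres h a & y = cres h b]) s t }.

(* The points that factor, on some chart, through the quotient by the
   congruence. *)
Definition cs_points (Z : closed_subscheme) : set points :=
  [set p | exists (U : chart Y) (q : alghom (calg U) (alg_self R)),
     p = point_class q /\ forall s t, Z U s t -> q s = q t].

Definition strong_zariski_closed (C : set points) : Prop :=
  exists Z : closed_subscheme, C = cs_points Z.

End GSchemePoints.

Section Mulmon.
Variables (A A' : comPzRingType) (f : {rmorphism A -> A'}).

Definition mulmon_hom : f1hom (mulmon A) (mulmon A') :=
  @F1Hom (mulmon A) (mulmon A') f (rmorphM f) (rmorph1 f) (rmorph0 f).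

End Mulmon.

Section Universal.
Variables (R : realType) (k : fieldType) (nu : k -> trop R) (X : scheme k).

Definition ev (U : affine_open X) (f : tensor (mulmon (sec U)) k) : sec U :=
  term_sum (fun (a : mulmon (sec U)) c => kinj U c * (a : sec U)) f.

Definition ev_ker (U : affine_open X) : set (tensor (mulmon (sec U)) k) :=
  [set f | ev f = 0].

Definition hat_res (S : comPzSemiRingType) (U V : affine_open X)
    (h : V `<=` U) : tensor (mulmon (sec U)) S -> tensor (mulmon (sec V)) S :=
  tmap (mulmon_hom (res h)).

Definition set_trop_pre : Type :=
  {U : affine_open X & set_trop_local nu (@ev_ker U)}.

Definition set_trop_step (p q : set_trop_pre) : Prop :=
  exists h : tag p `<=` tag q,
    forall g, sval (tagged q) g = sval (tagged p) (hat_res h g).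

Definition set_trop_univ : Type := quo set_trop_step.

Definition set_trop_class (U : affine_open X)
    (q : set_trop_local nu (@ev_ker U)) : set_trop_univ :=
  cls set_trop_step
    (existT (fun U => set_trop_local nu (@ev_ker U)) U q).

Lemma kinj_res (U V : affine_open X) (h : V `<=` U) c :
  res h (kinj U c) = kinj V c.
Proof. exact: res_comp. Qed.

Fact kinj0 (U : affine_open X) : kinj U 0 = 0.
Proof. by rewrite /kinj !rmorph0. Qed.

Fact kinjD (U : affine_open X) : {morph kinj U : c d / c + d}.
Proof. by move=> c d; rewrite /kinj !rmorphD. Qed.

Lemma ev_hat_res (U V : affine_open X) (h : V `<=` U)
    (f : tensor (mulmon (sec U)) k) :
  ev (hat_res h f) = res h (ev f).
Proof.
have evD (W : affine_open X) : {morph @ev W : f g / f + g}.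
  by apply: term_sumD => [b|b c d]; rewrite ?kinj0 ?mul0r ?kinjD ?mulrDl.
have evM (W : affine_open X) c a : @ev W (mon c a) = kinj W c * a.
  by apply: term_sum_mon => [b|]; rewrite ?kinj0 ?mul0r ?mulr0.
elim/tensor_ind: f => [|f g Hf Hg|c a].
- by rewrite /hat_res raddf0 /ev !term_sum0 rmorph0.
- by rewrite /hat_res raddfD /= !evD Hf Hg rmorphD.
by rewrite /hat_res tmap_mon !evM rmorphM kinj_res.
Qed.

Hypothesis hX : integral_scheme X.

Lemma res_injective (U : affine_open X) (V : opens (pts X)) (h : V `<=` U) :
  opens_set V !=set0 -> injective (res h).
Proof.
move=> [x Vx].
have Ux := h x Vx.
have [_ domX] := hX; have [_ domU] := domX U (ex_intro _ x Ux).
suff ker0 s : res h s = 0 -> s = 0.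
  move=> s t st; apply/subr0_eq/ker0.
  by rewrite rmorphB st subrr.
move=> s0; have [phi [bij zar loc]] := proj2_sig U.
have [E VE] := (zar V h).1 (proj2_sig V).
move: (Vx); rewrite VE => -[_ [f Ef fx]].
pose D := [set y | opens_set U y /\ ~ phi y f].
have DU : D `<=` U by move=> y [].
have DV : D `<=` V by move=> y [Uy fy]; rewrite VE; split=> //; exists f.
have oD : open D.
  apply/(zar D DU); exists [set f]; apply/seteqP; split=> y [Uy].
    by move=> fy; split=> //; exists f.
  by move=> [g -> gy].
pose Do : opens (pts X) := exist _ D oD.
have [_ _ /(_ s 0)] := loc f Do DU erefl.
have DV' : Do `<=` V by [].
have -> : res (DU : Do `<=` U) s = 0.
  by rewrite -(res_comp h DV') s0 rmorph0.
rewrite rmorph0 => /(_ erefl)[n]; rewrite mulr0.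
have f0 : f <> 0.
  move=> f0; apply: fx; rewrite f0.
  by have [/(_ x Ux)[]] := bij.
by elim: n => [|n IH]; rewrite ?mul1r // exprS -mulrA => /domU[].
Qed.

Lemma sec_empty (V : opens (pts X)) : ~ (opens_set V !=set0) ->
  forall s t : sec V, s = t.
Proof.
move=> V0 s t.
pose W (i : False) : opens (pts X) := match i with end.
have h i : W i `<=` V by case: i.
have VW : opens_set V `<=` \bigcup_i opens_set (W i).
  by move=> x Vx; case: V0; exists x.
by apply: (@sheaf_separated X False V W h VW s t) => -[].
Qed.

Fact hat_res_bend (U V : affine_open X) (h : V `<=` U) a b :
  bend nu (@ev_ker U) a b ->
  bend nu (@ev_ker V) (hat_res h a) (hat_res h b).
Proof.
have [V0|V0] := pselect (opens_set V !=set0); last first.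
  move=> _; suff -> : hat_res h a = hat_res h b by exact: cong_refl.
  apply/tensorP => x.
  by rewrite (sec_empty V0 x (f1zero (mulmon (sec V)))) !coef0.
have hI : injective (mulmon_hom (res h)) by exact: res_injective.
move=> ab.
have r (x y : tensor_alg (mulmon (sec U)) (trop R)) :
    bend nu (@ev_ker V) (hat_res h x) (hat_res h y) ->
    bend nu (@ev_ker V) (hat_res h y) (hat_res h x) by exact: cong_sym.
pose E := @Congruence (tensor_alg (mulmon (sec U)) (trop R))
  (fun x y => bend nu (@ev_ker V) (hat_res h x) (hat_res h y))
  (fun x => cong_refl _ _) r.
have E3 : forall b a c, bend nu (@ev_ker V) (hat_res h a) (hat_res h b) ->
   bend nu (@ev_ker V) (hat_res h b) (hat_res h c) ->
   bend nu (@ev_ker V) (hat_res h a) (hat_res h c).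
  by move=> y x z; exact: cong_trans.
have ED : forall a b c d, bend nu (@ev_ker V) (hat_res h a) (hat_res h b) ->
   bend nu (@ev_ker V) (hat_res h c) (hat_res h d) ->
   bend nu (@ev_ker V) (hat_res h (a + c)) (hat_res h (b + d)).
  by move=> x y z t; rewrite /hat_res !rmorphD; exact: congD.
have EM : forall a b c d, bend nu (@ev_ker V) (hat_res h a) (hat_res h b) ->
   bend nu (@ev_ker V) (hat_res h c) (hat_res h d) ->
   bend nu (@ev_ker V) (hat_res h (a * c)) (hat_res h (b * d)).
  by move=> x y z t; rewrite /hat_res !rmorphM; exact: congM.
apply: (ab (E E3 ED EM)) => x y [xI xy] F; apply; split.
  apply: trop_ideal_tmap xI => // f fI.
  by rewrite /ev_ker /= -[tmap _ _]/(hat_res h f) ev_hat_res fI rmorph0.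
exact: term_deleted_tmap.
Qed.

Definition hat_res_alg (U V : affine_open X) (h : V `<=` U) :
    alghom (tensor_alg (mulmon (sec U)) (trop R))
           (tensor_alg (mulmon (sec V)) (trop R)) :=
  @AlgHom _ (tensor_alg (mulmon (sec U)) (trop R))
    (tensor_alg (mulmon (sec V)) (trop R))
    (tmap (mulmon_hom (res h))) (@tmap_cst _ _ _ (mulmon_hom (res h))).

Definition trop_chart (U : affine_open X) : alg (trop R) :=
  trop_alg nu (@ev_ker U).

Definition trop_res (U V : affine_open X) (h : V `<=` U) :
    alghom (trop_chart U) (trop_chart V) :=
  @quot_map _ _ _ (bend nu (@ev_ker U)) (bend nu (@ev_ker V))
    (hat_res_alg h) (@hat_res_bend U V h).

Lemma trop_res_pi (U V : affine_open X) (h : V `<=` U) a :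
  trop_res h (quot_pi (bend nu (@ev_ker U)) a) =
  quot_pi (bend nu (@ev_ker V)) (hat_res h a).
Proof. exact: (@quot_map_pi _ _ _ _ _ (hat_res_alg h) (@hat_res_bend U V h)). Qed.

Fact trop_res_id (U : affine_open X) (h : U `<=` U) s : trop_res h s = s.
Proof.
have [a ->] : exists a, s = quot_pi (bend nu (@ev_ker U)) a.
  by exists (srepr s); exact: esym (sreprK s).
rewrite trop_res_pi /hat_res; congr (quot_pi _ _).
by apply: tmap_id => b; exact: res_id.
Qed.

Fact trop_res_comp (U V W : affine_open X) (h : V `<=` U) (h' : W `<=` V)
  (h'' : W `<=` U) s : trop_res h' (trop_res h s) = trop_res h'' s.
Proof.
have [a ->] : exists a, s = quot_pi (bend nu (@ev_ker U)) a.
  by exists (srepr s); exact: esym (sreprK s).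
rewrite !trop_res_pi /hat_res; congr (quot_pi _ _).
by apply: tmap_comp => b; exact: res_comp.
Qed.

(* Integrality makes the restriction maps injective, which is what makes the
   local tropicalizations functorial. *)
Definition trop_univ : gscheme (trop R) :=
  @GScheme (trop R) (affine_open X) (fun V U => V `<=` U)
    (fun U => @subset_refl _ U) (fun V U W h h' => subset_trans h h')
    trop_chart trop_res trop_res_id trop_res_comp.

End Universal.

(* Main.v *)
(* On an affine chart U = Spec A a T-algebra map q out of the free semimodule
   on A is determined by w a = q(x_a).  The bend relations of trop(I) hold at q
   as soon as those of the generators do, because deleting a term is additive
   and, A being a domain, commutes with multiplication by a monomial.  The
   relations coming from x_a + x_b - x_(a+b) and x_c - c x_1 say exactly that w
   is a semivaluation extending nu, so T-points, tropical solutions and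
   semivaluations are the same thing, chart by chart.

   For the topology, a locus [s = t] is closed since s and t are continuous
   functions of w.  Conversely basic open sets are complements of loci
   [min(w a, u) = w a] or [min(w a, l) = l], and finite unions of such loci are
   again given by one equation, so every closed set is the zero locus of the
   congruence of all pairs agreeing on it.  Vanishing of a congruence sheaf at a
   point does not depend on the chart: the support of w is a prime ideal, hence
   a point of the scheme, and w lives on a basic open neighbourhood D(f) of it,
   where the tropical chart of D(f) is the localization at x_f. *)

From HB Require Import structures.
From Stdlib Require Import Relation_Operators.
From mathcomp Require Import all_boot all_order all_algebra finmap.
From mathcomp Require Import all_classical all_reals all_analysis.
Require Import Defs.

Set Implicit Arguments.
Unset Strict Implicit.
Unset Printing Implicit Defensive.

Import Order.TTheory GRing.Theory Num.Theory.
Import numFieldNormedType.Exports.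

Local Open Scope classical_set_scope.
Local Open Scope ring_scope.

(** * Quotients, algebra maps and free modules *)

Section Quo.
Variables (A A' : Type) (r : A -> A -> Prop) (r' : A' -> A' -> Prop).

Lemma clsP a b : cls r a = cls r b <-> clos_refl_sym_trans A r a b.
Proof.
split=> [/(congr1 sval)/= E|ab].
  have : [set c | clos_refl_sym_trans A r b c] b by exact: rst_refl.
  by rewrite -E.
apply/eq_exist/seteqP; split=> c /= h.
  by apply: rst_trans h; apply: rst_sym.
exact: rst_trans h.
Qed.

Lemma cls_surj (x : quo r) : exists a, x = cls r a.
Proof. by case: x => C h; have [a E] := h; exists a; apply: eq_exist. Qed.

Lemma clos_map (F : A -> A') a b : (forall x y, r x y -> r' (F x) (F y)) ->
  clos_refl_sym_trans A r a b -> clos_refl_sym_trans A' r' (F a) (F b).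
Proof.
move=> rF; elim=> [x y /rF|x|x y _|x y z _ h _].
- exact: rst_step.
- exact: rst_refl.
- exact: rst_sym.
- exact: rst_trans h.
Qed.

End Quo.

(** Preservation of steps in both directions carries zigzags to zigzags, so mutually inverse maps of
    representatives descend. This yields both identifications of colimits from chartwise ones. *)
Lemma quo_bij (A A' : Type) (r : A -> A -> Prop) (r' : A' -> A' -> Prop)
    (F : A -> A') (G : A' -> A) : cancel F G -> cancel G F ->
  (forall x y, r x y -> r' (F x) (F y)) ->
  (forall x y, r' x y -> r (G x) (G y)) ->
  exists2 f : quo r -> quo r', bijective f & forall a, f (cls r a) = cls r' (F a).
Proof.
move=> FK GK rF rG.
(* The descended maps are defined on chosen representatives; compatibility with the steps makes the
   choice irrelevant. *)
pose rep (B : Type) (s : B -> B -> Prop) (x : quo s) := projT1 (cid (cls_surj x)).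
have repK B (s : B -> B -> Prop) (x : quo s) : x = cls s (rep _ _ x).
  exact: projT2 (cid (cls_surj x)).
exists (fun x => cls r' (F (rep _ _ x))) => [|a]; last first.
  by apply/clsP/(clos_map rF)/clsP; rewrite -repK.
exists (fun x => cls r (G (rep _ _ x))) => x.
  rewrite [RHS]repK -[in RHS](FK (rep _ _ x)).
  by apply/clsP/(clos_map rG)/clsP; rewrite -repK.
rewrite [RHS]repK -[in RHS](GK (rep _ _ x)).
by apply/clsP/(clos_map rF)/clsP; rewrite -repK.
Qed.

(** Once unpacked, two homomorphisms with the same underlying function differ only in proofs, which
    proof irrelevance identifies. *)
Lemma alghom_ext (S : comPzSemiRingType) (A A' : alg S) (f g : alghom A A') :
  f =1 g -> f = g.
Proof.
case: f g => [f fE] [g gE] /= /funext.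
case: f fE => f [[f1] [f2]]; case: g gE => g [[g1] [g2]] gE fE /= fg.
subst g; move: g1 g2 gE => g1 g2.
rewrite (Prop_irrelevance g1 f1) (Prop_irrelevance g2 f2) => gE.
by rewrite (Prop_irrelevance gE fE).
Qed.

Section QuotLift.
Variables (S : comPzSemiRingType) (A C : alg S) (E : congruence A).
Variable (f : alghom A C).
Hypothesis fE : forall a b, E a b -> f a = f b.

Definition quot_lift_fun (x : quot_alg E) : C := f (srepr x).

Lemma quot_lift_pi a : quot_lift_fun (quot_pi E a) = f a.
Proof. exact/fE/srepr_spi. Qed.

Lemma quot_piP (x : quot_alg E) : exists a, x = quot_pi E a.
Proof. by exists (srepr x); exact: esym (sreprK x). Qed.

Fact quot_lift_nmod : nmod_morphism quot_lift_fun.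
Proof.
split=> [|x y].
  by rewrite -(rmorph0 (quot_pi E)) quot_lift_pi rmorph0.
have [[a ->] [b ->]] := (quot_piP x, quot_piP y).
by rewrite -rmorphD !quot_lift_pi rmorphD.
Qed.

Fact quot_lift_monoid : monoid_morphism quot_lift_fun.
Proof.
split=> [|x y].
  by rewrite -(rmorph1 (quot_pi E)) quot_lift_pi rmorph1.
have [[a ->] [b ->]] := (quot_piP x, quot_piP y).
by rewrite -rmorphM !quot_lift_pi rmorphM.
Qed.

HB.instance Definition _ :=
  GRing.isNmodMorphism.Build _ _ quot_lift_fun quot_lift_nmod.
HB.instance Definition _ :=
  GRing.isMonoidMorphism.Build _ _ quot_lift_fun quot_lift_monoid.

Fact quot_lift_str c : quot_lift_fun (alg_str (quot_alg E) c) = alg_str C c.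
Proof. by rewrite -(alg_funE (quot_pi E)) quot_lift_pi alg_funE. Qed.

Definition quot_lift : alghom (quot_alg E) C :=
  @AlgHom _ _ _ quot_lift_fun quot_lift_str.

End QuotLift.

Section TensorEval.
Variables (B : f1alg) (S : comPzSemiRingType) (w : B -> S).
Hypotheses (w0 : w (f1zero B) = 0) (w1 : w (f1one B) = 1).
Hypothesis wM : forall a b, w (f1mul a b) = w a * w b.

Definition ten_eval (f : tensor B S) : S := term_sum (fun b c => c * w b) f.

Fact ten_eval_nmod : nmod_morphism ten_eval.
Proof.
split=> [|f g]; first exact: term_sum0.
by apply: term_sumD => *; rewrite ?mul0r ?mulrDl.
Qed.
HB.instance Definition _ := GRing.isNmodMorphism.Build _ _ ten_eval ten_eval_nmod.

Lemma ten_eval_mon c b : ten_eval (mon c b) = c * w b.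
Proof. by apply: term_sum_mon => *; rewrite ?mul0r ?w0 ?mulr0. Qed.

Fact ten_eval_monoid : monoid_morphism ten_eval.
Proof.
split=> [|f g]; first by rewrite [LHS]ten_eval_mon w1 mulr1.
elim/tensor_ind: f => [|f f' Hf Hf'|c a].
- by rewrite !(mul0r, raddf0).
- by rewrite mulrDl !raddfD /= Hf Hf' mulrDl.
elim/tensor_ind: g => [|g g' Hg Hg'|d b].
- by rewrite !(mulr0, raddf0).
- by rewrite mulrDr !raddfD /= Hg Hg' mulrDr.
by rewrite mulmon_mon !ten_eval_mon wM mulrACA.
Qed.
HB.instance Definition _ :=
  GRing.isMonoidMorphism.Build _ _ ten_eval ten_eval_monoid.

Fact ten_eval_cst c : ten_eval (ten_cst B c) = c.
Proof. by rewrite ten_eval_mon w1 mulr1. Qed.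

(** Existence half of the universal property of the monoid algebra; [hom_ten_eval] is the uniqueness
    half. *)
Definition ten_eval_hom : alghom (tensor_alg B S) (alg_self S) :=
  @AlgHom S (tensor_alg B S) (alg_self S) ten_eval ten_eval_cst.

End TensorEval.

Section Points.
Variables (B : f1alg) (S : comPzSemiRingType).
Variable q : alghom (tensor_alg B S) (alg_self S).

Lemma hom_mon c b : q (mon c b) = c * q (mon 1 b).
Proof.
have -> : mon c b = ten_cst B c * mon 1 b by rewrite mulmon_mon mulr1 f1mul1.
by rewrite rmorphM; congr (_ * _); exact: (alg_funE q c).
Qed.

Lemma hom_ten_eval f : q f = ten_eval (fun b => q (mon 1 b)) f.
Proof.
by rewrite -[in LHS](term_sum_id f) raddf_sum; apply: eq_bigr => b _; exact: hom_mon.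
Qed.

Lemma hom_mon0 : q (mon 1 (f1zero B)) = 0.
Proof. by rewrite mon_zero rmorph0. Qed.

Lemma hom_mon1 : q (mon 1 (f1one B)) = 1.
Proof. exact: rmorph1. Qed.

Lemma hom_monM a b : q (mon 1 (f1mul a b)) = q (mon 1 a) * q (mon 1 b).
Proof. by rewrite -rmorphM mulmon_mon mulr1. Qed.

End Points.

(** * Deletion of a monomial term *)

Section DropTerm.
Variables (B : f1alg) (S : comPzSemiRingType).
Implicit Types f g : tensor B S.

(** A total, additive counterpart of the relation [term_deleted]; it is the identity when [b] does
    not occur in [g]. *)
Definition drop_term (b : B) g : tensor B S :=
  term_sum (fun c e => if c == b then 0 else mon e c) g.

Fact drop_term_nmod b : nmod_morphism (drop_term b).
Proof.
split=> [|f g]; first exact: term_sum0.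
by apply: term_sumD => *; case: ifP => //; rewrite ?mon0 ?addr0 ?monD.
Qed.
HB.instance Definition _ b :=
  GRing.isNmodMorphism.Build _ _ (drop_term b) (drop_term_nmod b).

Lemma drop_term_mon b e c : drop_term b (mon e c) = if c == b then 0 else mon e c.
Proof.
by apply: term_sum_mon => [c'|]; rewrite ?mon0 ?mon_zero if_same.
Qed.

Lemma coef_drop_term b g c : coef (drop_term b g) c = if c == b then 0 else coef g c.
Proof.
elim/tensor_ind: g => [|f f' Hf Hf'|e a].
- by rewrite raddf0 coefZ0 if_same.
- by rewrite raddfD /= !coefD Hf Hf'; case: ifP; rewrite ?addr0.
rewrite drop_term_mon; case: eqP => [->|ab]; rewrite ?coefZ0 monE.
  by case: (c == b).
by case: (c =P b) => // ->; case: eqP => // E; case: ab.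
Qed.

Lemma drop_term_id b g : coef g b = 0 -> drop_term b g = g.
Proof.
by move=> gb; apply/tensorP => c; rewrite coef_drop_term; case: eqP => // ->.
Qed.

(** Cancellation of [a] ensures that only the [b]-term of [g] can land on the monomial
    [f1mul a b]. *)
Lemma drop_term_mulmon (a b : B) d g : injective (f1mul a) ->
  drop_term (f1mul a b) (mon d a * g) = mon d a * drop_term b g.
Proof.
move=> aI; elim/tensor_ind: g => [|f f' Hf Hf'|e c].
- by rewrite !(raddf0, mulr0).
- by rewrite mulrDr !raddfD /= Hf Hf' mulrDr.
rewrite mulmon_mon !drop_term_mon (inj_eq aI) //.
by case: ifP; rewrite ?mulr0 ?mulmon_mon.
Qed.

Lemma drop_term_mulmonN (a b : B) d g : (forall c, f1mul a c <> b) ->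
  drop_term b (mon d a * g) = mon d a * g.
Proof.
move=> ab; elim/tensor_ind: g => [|f f' Hf Hf'|e c].
- by rewrite !(raddf0, mulr0).
- by rewrite mulrDr !raddfD /= Hf Hf'.
by rewrite mulmon_mon drop_term_mon; case: eqP => // /ab.
Qed.

End DropTerm.

Lemma term_deletedP (R : realType) (B : f1alg) (g g' : tensor B (trop R)) :
  term_deleted g g' <-> exists2 b, b \in finsupp (coef g) & g' = drop_term b g.
Proof.
split=> -[b bg].
  move=> [g'b g'E]; exists b => //; apply/tensorP => c; rewrite coef_drop_term.
  by case: eqP => [->//|/eqP/g'E].
move=> ->; exists b => //; split=> [|c /negPf cb]; rewrite coef_drop_term ?eqxx //.
by rewrite cb.
Qed.

(** * Tropical arithmetic *)

Section TropArith.
Variable R : realType.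
Implicit Types x y z s t : trop R.

Lemma tadd_idem x : x + x = x.
Proof. by case: x => [a|] //; congr Some; rewrite minxx. Qed.

Lemma tadd_sel x y : x + y = x \/ x + y = y.
Proof.
case: x y => [a|] [b|]; [|by left|by right|by left].
by have [ab|ab] := leP a b; [left|right]; congr Some;
  [apply/min_idPl|apply/min_idPr/ltW].
Qed.

Lemma tadd_eq0 x y : x + y = 0 -> x = 0 /\ y = 0.
Proof. by case: x y => [a|] [b|]. Qed.

Lemma trop_one_neq0 : (1 : trop R) <> 0.
Proof. by []. Qed.

Lemma tmul_eq0 x y : x * y = 0 -> x = 0 \/ y = 0.
Proof. by case: x y => [a|] [b|] //; [right|left|left]. Qed.

Lemma tmul_inv x : x <> 0 -> exists y, y * x = 1.
Proof.
case: x => [a _|]; last by case.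
by exists (Some (- a)); congr Some; rewrite addNr.
Qed.

Lemma expN_ge0 x : 0 <= expN x.
Proof. by case: x => [a|] //=; exact: expR_ge0. Qed.

(** [expN] reverses the order, so minima become maxima; with [expNM] this moves questions about
    [trop R] to nonnegative reals under max and product. *)
Lemma expND x y : expN (x + y) = Num.max (expN x) (expN y).
Proof.
case: x y => [a|] [b|] /=; last by rewrite maxxx.
- have [ab|ab] := leP a b; last first.
    by rewrite (max_idPr _) // ler_expR lerN2 ltW.
  by rewrite (max_idPl _) // ler_expR lerN2.
- by rewrite (max_idPl _) // expR_ge0.
- by rewrite (max_idPr _) // expR_ge0.
Qed.

Lemma expNM x y : expN (x * y) = expN x * expN y.
Proof.
case: x y => [a|] [b|] /=; rewrite ?mulr0 ?mul0r //.
by rewrite opprD expRD.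
Qed.

Lemma expN_inj : injective (@expN R).
Proof.
move=> [a|] [b|] //=.
- by move/expR_inj/oppr_inj ->.
- by move=> /eqP; rewrite expR_eq0.
- by move=> /esym/eqP; rewrite expR_eq0.
Qed.

Lemma expN_surj (e : R) : 0 <= e -> exists x, expN x = e.
Proof.
rewrite le_eqVlt => /orP[/eqP<-|e0]; first by exists 0.
by exists (Some (- ln e)); rewrite /= opprK lnK.
Qed.

(* The union of the loci [s = t] and [s' = t'] is again the locus of an
   equation; this is what makes unions of two closed sets closed. *)
Lemma twisted_eq s t s' t' :
  s * s' + t * t' = s * t' + t * s' <-> s = t \/ s' = t'.
Proof.
split; last first.
  by move=> [->|->]; rewrite // addrC.
move/(congr1 (@expN R)); rewrite !expND !expNM => E.
suff : expN s = expN t \/ expN s' = expN t'.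
  by move=> [/expN_inj->|/expN_inj->]; [left|right].
move: (expN_ge0 s) (expN_ge0 t) (expN_ge0 s') (expN_ge0 t') E.
move: (expN s) (expN t) (expN s') (expN t') => {}s {}t {}s' {}t' s0 t0 s'0 t'0.
(* Strict rearrangement: [y * y'] exceeds both mixed products. *)
have key (x y x' y' : R) : x < y -> x' < y' -> 0 <= x -> 0 <= x' ->
    Num.max (x * x') (y * y') <> Num.max (x * y') (y * x').
  move=> xy xy' x0 x0'; have y0 := le_lt_trans x0 xy.
  have y0' := le_lt_trans x0' xy'.
  apply/eqP; rewrite gt_eqF // gt_max !lt_max.
  by rewrite (ltr_pM2r y0') xy (ltr_pM2l y0) xy' !orbT.
have [st|st|->] := ltgtP s t; [| |by left];
  have [st'|st'|->] := ltgtP s' t'; try by [right].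
- by move=> /(key _ _ _ _ st st' s0 s'0).
- by move/esym/(key _ _ _ _ st st' s0 t'0).
- by rewrite maxC [RHS]maxC => /esym/(key _ _ _ _ st st' t0 s'0).
- by rewrite maxC [RHS]maxC => /(key _ _ _ _ st st' t0 t'0).
Qed.

Lemma tsum_eq0 (I : eqType) (r : seq I) (F : I -> trop R) i :
  \sum_(j <- r) F j = 0 -> i \in r -> F i = 0.
Proof.
elim: r => [|j r IH] //; rewrite big_cons => /tadd_eq0[Fj /IH Fi].
by rewrite inE => /orP[/eqP->|].
Qed.

Lemma tsum_sel (I : eqType) (r : seq I) (F : I -> trop R) :
  \sum_(i <- r) F i = 0 \/
  exists2 i, i \in r & F i = \sum_(i <- r) F i.
Proof.
elim: r => [|j r IH]; first by left; rewrite big_nil.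
rewrite big_cons; have [->|->] := tadd_sel (F j) (\sum_(i <- r) F i).
  by right; exists j; rewrite ?mem_head.
have [->|[i ir Fi]] := IH; [by left|right].
by exists i; rewrite ?inE ?ir ?orbT.
Qed.

Lemma tsum_absorb (I : eqType) (r : seq I) (F : I -> trop R) i :
  i \in r -> F i + \sum_(j <- r) F j = \sum_(j <- r) F j.
Proof.
elim: r => [|j r IH] //; rewrite big_cons inE => /orP[/eqP->|/IH ir].
  by rewrite addrA tadd_idem.
by rewrite addrCA ir.
Qed.

(* The minimum is infinite or attained at least twice exactly when deleting
   any one term does not change it. *)
Lemma tsum_bend (K : choiceType) (S : {fset K}) (F : K -> trop R) :
  (forall b, b \in S -> \sum_(c <- (S `\ b)%fset) F c = \sum_(c <- S) F c) <->
  (\sum_(c <- S) F c = 0 \/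
   exists b b', [/\ b \in S, b' \in S, b != b', F b = \sum_(c <- S) F c &
                   F b' = \sum_(c <- S) F c]).
Proof.
split=> [h|h b bS].
  have [->|[b bS tb]] := tsum_sel S F; first by left.
  have [E|[b' bS' tb']] := tsum_sel (S `\ b)%fset F.
    by left; rewrite -(h b bS).
  right; exists b, b'; move: bS'; rewrite in_fsetD1 => /andP[b'b b'S].
  by rewrite eq_sym b'b; split=> //; rewrite tb' h.
(* A minimal term other than [b] survives the deletion and keeps the minimum; of two distinct
   minimal terms at most one is [b]. *)
have key c : c != b -> c \in S -> F c = \sum_(c <- S) F c ->
    \sum_(c <- (S `\ b)%fset) F c = \sum_(c <- S) F c.
  move=> cb cS tc.
  have /(tsum_absorb F) cSb : c \in (S `\ b)%fset by rewrite in_fsetD1 cb.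
  by rewrite -[LHS]cSb tc {1}(big_fsetD1 b) //= -addrA tadd_idem -big_fsetD1.
case: h => [h|[c [c' [cS c'S cc' tc tc']]]].
  rewrite h big_seq big1 // => c; rewrite in_fsetD1 => /andP[_ cS].
  exact: tsum_eq0 h cS.
have [E|cb] := eqVneq c b; last exact: key tc.
by apply: (key c') => //; rewrite -E eq_sym.
Qed.

Variables (A : comPzRingType) (w : A -> trop R).
Hypothesis w_sv : semivaluation w.

Lemma semivaluationN a : w (- a) = w a.
Proof. by case: w_sv => _ [_ wN1] wM _; rewrite -mulN1r wM wN1 mul1r. Qed.

(** The ultrametric inequality for finite sums, since [x + y = y] in [trop R] says that [y] is at
    most [x]. *)
Lemma semivaluation_sum (I : Type) (r : seq I) (F : I -> A) :
  w (\sum_(i <- r) F i) + \sum_(i <- r) w (F i) = \sum_(i <- r) w (F i).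
Proof.
case: w_sv => w0 _ _ wD; elim: r => [|i r IH]; first by rewrite !big_nil w0 addr0.
rewrite !big_cons -IH; set s := \sum_(j <- r) F j; set S := \sum_(j <- r) _.
by rewrite !addrA wD.
Qed.

End TropArith.

Lemma coef_ten_nu (R : realType) (k : fieldType) (nu : k -> trop R) (B : f1alg)
    (f : tensor B k) b : semivaluation nu -> coef (ten_nu nu f) b = nu (coef f b).
Proof. by move=> [nu0 _ _ _]; rewrite ten_nuE; case: finsuppP. Qed.

(** * Affine tropicalizations and valuations *)

Section KernelCongruence.
Variables (S : comPzSemiRingType) (A C : alg S) (q : alghom A C).

(** [gen_rel] quantifies over all congruences that contain the generators; instantiating it here
    reduces a claim about generated pairs to the generators. *)
Definition hom_ker : congruence A.
Proof.
apply: (@Congruence A (fun a b => q a = q b)) => //.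
- by move=> b a c -> ->.
- by move=> a b c d ab cd; rewrite !rmorphD ab cd.
- by move=> a b c d ab cd; rewrite !rmorphM ab cd.
Defined.

End KernelCongruence.

Section LocalSolutions.
Variables (R : realType) (k : fieldType) (nu : k -> trop R) (B : f1alg).
Variable I : set (tensor B k).
Variable q : alghom (tensor_alg B (trop R)) (alg_self (trop R)).

Definition bends_at (g : tensor B (trop R)) : Prop :=
  forall b, q (drop_term b g) = q g.

(** Lets the tropical condition be tested on the generators [ten_nu nu f] of [trop_ideal].
    Additivity of deletion reduces closure under products to multiplication by one monomial. *)
Lemma bends_at_ideal : (forall a : B, a <> f1zero B -> injective (f1mul a)) ->
  is_ideal bends_at.
Proof.
move=> mulI; have bD f g : bends_at f -> bends_at g -> bends_at (f + g).
  by move=> hf hg b; rewrite !raddfD /= hf hg.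
have b0 : bends_at 0 by move=> b; rewrite !raddf0.
split=> // f g gI; elim/tensor_ind: f => [|f f' Hf Hf'|c a].
- by rewrite mul0r.
- by rewrite mulrDl; apply: bD.
have [->|a0] := pselect (a = f1zero B); first by rewrite mon_zero mul0r.
(* A monomial that is not a multiple of [a] does not occur in the product, so deleting it changes
   nothing. *)
move=> b; have [[b' <-]|nb] := pselect (exists b', f1mul a b' = b).
  rewrite drop_term_mulmon; last exact: mulI.
  by rewrite !rmorphM; congr (_ * _); exact: gI.
by rewrite drop_term_mulmonN // => b' hb; apply: nb; exists b'.
Qed.

(** [tsum_bend] turns the minimum condition into invariance under deletion; outside the support of
    [f] deletion is trivial. *)
Lemma trop_solutionP :
  trop_solution nu I q <-> forall f, I f -> bends_at (ten_nu nu f).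
Proof.
have E f b : b \in finsupp (coef f) -> q (drop_term b (ten_nu nu f)) =
    \sum_(c <- (finsupp (coef f) `\ b)%fset) q (mon (nu (coef f c)) c).
  move=> bf; rewrite /ten_nu /term_sum (big_fsetD1 b) //= raddfD /=.
  rewrite drop_term_mon eqxx add0r (raddf_sum (drop_term b)).
  rewrite (raddf_sum q) big_seq [RHS]big_seq.
  apply: eq_bigr => c; rewrite in_fsetD1 => /andP[/negPf cb _].
  by rewrite /= drop_term_mon cb.
split=> h f If; last first.
  apply/tsum_bend => b bf; rewrite -E // (h f If).
  by rewrite /ten_nu /term_sum raddf_sum.
move=> b; have [bf|bf] := boolP (b \in finsupp (coef f)); last first.
  by rewrite drop_term_id // ten_nuE (negPf bf).
rewrite E // [in RHS]/ten_nu /term_sum raddf_sum.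
exact: ((tsum_bend _ (fun c => q (mon (nu (coef f c)) c))).2 (h f If) b bf).
Qed.

Lemma bend_solution : (forall a : B, a <> f1zero B -> injective (f1mul a)) ->
  trop_solution nu I q -> forall a b, bend nu I a b -> q a = q b.
Proof.
move=> mulI /trop_solutionP h a b ab; apply: (ab (hom_ker q)) => x y [xI].
move=> /term_deletedP[c _ ->] /=; apply/esym.
by apply: (xI bends_at) => //; exact: bends_at_ideal.
Qed.

Lemma solution_bend :
  (forall a b, bend nu I a b -> q a = q b) -> trop_solution nu I q.
Proof.
move=> h; apply/trop_solutionP => f If b.
(* Only terms in the support of [ten_nu nu f] give bend relations; deletion elsewhere is the
   identity. *)
have [bf|bf] := boolP (b \in finsupp (coef (ten_nu nu f))); last first.
  by rewrite drop_term_id // fsfun_dflt.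
apply/esym/h => E hE; apply: hE; split; first by move=> J _; apply.
by apply/term_deletedP; exists b.
Qed.

End LocalSolutions.

Section Valuations.
Variables (R : realType) (k : fieldType) (nu : k -> trop R) (X : scheme k).
Hypotheses (hnu : semivaluation nu) (hX : integral_scheme X).
Variable U : affine_open X.

Let T := trop R.
Let A := tensor (mulmon (sec U)) T.

Lemma ev_mon c (a : sec U) : ev (@mon (mulmon (sec U)) k c a) = kinj U c * a.
Proof. by apply: term_sum_mon => [b|]; rewrite ?kinj0 ?mul0r ?mulr0. Qed.

Lemma evD : {morph @ev k X U : f g / f + g}.
Proof. by apply: term_sumD => [b|b c d]; rewrite ?kinj0 ?mul0r ?kinjD ?mulrDl. Qed.

Definition val_hom (w : berkovich_affine nu U) :
    alghom (tensor_alg (mulmon (sec U)) T) (alg_self T).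
Proof.
apply: (@ten_eval_hom (mulmon (sec U)) T (sval w)).
- by have [[]] := proj2_sig w.
- by have [[_ []]] := proj2_sig w.
- by have [[]] := proj2_sig w.
Defined.

Lemma val_hom_mon (w : berkovich_affine nu U) c a :
  val_hom w (@mon (mulmon (sec U)) T c a) = c * sval w a.
Proof. by apply: ten_eval_mon; have [[]] := proj2_sig w. Qed.

Lemma kinj1 : kinj U 1 = 1.
Proof. by rewrite /kinj !rmorph1. Qed.

Lemma kinjN c : kinj U (- c) = - kinj U c.
Proof. by rewrite /kinj !rmorphN. Qed.

(** In a vanishing sum each term is minus the sum of the others, so by the ultrametric inequality
    its value is absorbed by theirs. *)
Lemma val_hom_solution w : trop_solution nu (@ev_ker k X U) (val_hom w).
Proof.
move=> f ev0; apply/tsum_bend => b bf.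
have [wsv wk] := proj2_sig w; have [_ _ wM _] := wsv.
under eq_bigr do rewrite val_hom_mon -wk -wM.
under [RHS]eq_bigr do rewrite val_hom_mon -wk -wM.
rewrite [RHS](big_fsetD1 b) //=.
set F := fun c : sec U => kinj U (coef f c) * c.
have -> : sval w (kinj U (coef f b) * b) =
    sval w (\sum_(c <- (finsupp (coef f) `\ b)%fset) F c).
  rewrite -[LHS](semivaluationN wsv); congr (sval w _).
  apply/eqP; rewrite eq_sym -addr_eq0 addrC; apply/eqP.
  by rewrite -[RHS]ev0 /ev /term_sum [RHS](big_fsetD1 b).
by rewrite (semivaluation_sum wsv).
Qed.

End Valuations.

Section SolutionValuation.
Variables (R : realType) (k : fieldType) (nu : k -> trop R) (X : scheme k).
Hypotheses (hnu : semivaluation nu) (hX : integral_scheme X).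
Variable U : affine_open X.

Let T := trop R.
Local Notation x_ a := (@mon (mulmon (sec U)) T 1 a).
Local Notation y_ c a := (@mon (mulmon (sec U)) k c a).

Section Hom.
Variable q : alghom (tensor_alg (mulmon (sec U)) T) (alg_self T).

(** In the zero ring the monomials at 1 and 0 coincide, and [q] would send 1 to infinity. *)
Lemma hom_nontrivial : (1 : sec U) <> 0.
Proof.
move=> E; apply: (@trop_one_neq0 R).
by rewrite -(hom_mon1 q) [f1one _]E (hom_mon0 q).
Qed.

Lemma hom_inhabited : opens_set U !=set0.
Proof.
by apply: contrapT => /sec_empty E; apply: hom_nontrivial; exact: E.
Qed.

(** The point [q] itself forces the chart to be nonempty, so that its sections form a domain. *)
Lemma hom_mulI (a : mulmon (sec U)) : a <> f1zero _ -> injective (f1mul a).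
Proof.
move=> a0 b c /= /eqP; rewrite -subr_eq0 -mulrBr => /eqP.
have [_ /[apply]] := hX.2 U hom_inhabited.
by case=> [//|/eqP]; rewrite subr_eq0 => /eqP.
Qed.

Hypothesis hq : trop_solution nu (@ev_ker k X U) q.

Let w (a : sec U) : T := q (x_ a).

(** The choice of the two deleted monomials turns an element of the kernel of [ev] into an equation
    for [q]. *)
Lemma solution_drop f b b' : ev f = 0 ->
  q (drop_term b (ten_nu nu f)) = q (drop_term b' (ten_nu nu f)).
Proof. by move=> f0; rewrite !((trop_solutionP _ _ _).1 hq). Qed.

Lemma solution_kinj c : w (kinj U c) = nu c.
Proof.
have [nu0 [nu1 nuN1] nuM _] := hnu.
have [->|c0] := eqVneq c 0; first by rewrite kinj0 nu0; exact: hom_mon0.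
have k0 : kinj U c <> 0.
  move=> E; apply: hom_nontrivial.
  by rewrite -(kinj1 U) -(mulVf c0) /kinj !rmorphM -/(kinj U c) E mulr0.
(* If the image of [c] is 1, the two monomials of the relation below merge; then [c = 1], because
   nonzero scalars do not map to 0. *)
have [E|c1] := pselect (kinj U c = 1).
  have -> : c = 1.
    apply/eqP; rewrite -subr_eq0; apply/negPn/negP => c1; apply: hom_nontrivial.
    rewrite -(kinj1 U) -(mulVf c1) /kinj !rmorphM -/(kinj U (c - 1)).
    by rewrite kinjD kinjN E kinj1 subrr mulr0.
  by rewrite kinj1 nu1; exact: hom_mon1.
(* Each of the two monomials, when deleted, leaves the other one. *)
pose f : tensor (mulmon (sec U)) k := y_ 1 (kinj U c) + y_ (- c) 1.
have fE : ev f = 0 by rewrite evD !ev_mon kinj1 kinjN mul1r mulr1 subrr.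
have := @solution_drop f (1 : sec U) (kinj U c) fE.
have -> : drop_term (B := mulmon (sec U)) (1 : sec U) (ten_nu nu f) = x_ (kinj U c).
  apply/tensorP => b; rewrite coef_drop_term (coef_ten_nu _ _ hnu) coefD !monE.
  case: (b =P 1) => [->|_] /=.
    by case: eqP => // /esym.
  by rewrite addr0; case: ifP => _; rewrite ?nu1 ?nu0.
have -> : drop_term (B := mulmon (sec U)) (kinj U c) (ten_nu nu f) =
    @mon (mulmon (sec U)) T (nu c) (1 : sec U).
  apply/tensorP => b; rewrite coef_drop_term (coef_ten_nu _ _ hnu) coefD !monE.
  case: (b =P kinj U c) => [->|_] /=.
    by case: eqP.
  rewrite add0r; case: ifP => _; last by rewrite nu0.
  by rewrite -mulN1r nuM nuN1 mul1r.
by move=> E; rewrite /w E hom_mon hom_mon1 mulr1.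
Qed.

Lemma solution_semivaluation : semivaluation w.
Proof.
have [nu0 [nu1 nuN1] nuM nuD] := hnu.
have w0 : w 0 = 0 by exact: hom_mon0.
have wM a b : w (a * b) = w a * w b by exact: (hom_monM q).
split=> //.
  split; first exact: hom_mon1.
  by rewrite -(kinj1 U) -kinjN solution_kinj.
move=> a b; have [->|a0] := eqVneq a 0; first by rewrite add0r w0 add0r addr0 tadd_idem.
have [->|b0] := eqVneq b 0; first by rewrite addr0 w0 !addr0 tadd_idem.
have [->|ab0] := eqVneq (a + b) 0; first by rewrite w0 add0r.
(* When [a = b], two monomials of the relation below would merge; here the sum is a scalar multiple
   of [a] instead. *)
have [<-|ab] := eqVneq a b.
  have -> : a + a = kinj U (1 + 1) * a by rewrite kinjD kinj1 mulrDl mul1r.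
  rewrite wM solution_kinj.
  have /(congr1 (fun x => x * w a)) := nuD 1 1.
  by rewrite nu1 !mulrDl mul1r.
have ab1 : a + b != a by rewrite -subr_eq0 addrAC subrr add0r.
have ab2 : a + b != b by rewrite -subr_eq0 addrK.
(* Three distinct monomials. Deleting those at [b] and [a + b] gives [w a + w (a + b) = w a + w b];
   idempotence then yields the law. *)
pose f : tensor (mulmon (sec U)) k := y_ 1 a + y_ 1 b + y_ (- 1) (a + b).
have fE : ev f = 0 by rewrite !evD !ev_mon kinjN kinj1 !mul1r mulN1r subrr.
have := @solution_drop f b (a + b) fE.
have -> : drop_term (B := mulmon (sec U)) b (ten_nu nu f) = x_ a + x_ (a + b).
  apply/tensorP => x; rewrite coef_drop_term (coef_ten_nu _ _ hnu) !coefD !monE.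
  case: (x =P b) => [->|_] /=.
    by rewrite ![b == _]eq_sym (negPf ab) (negPf ab2) addr0.
  rewrite addr0; case: (x =P a) => [->|_] /=.
    rewrite a0 [a == _]eq_sym (negPf ab1) /= !addr0; exact: nu1.
  by rewrite !add0r; case: ifP => _; rewrite ?nuN1 ?nu0.
have -> : drop_term (B := mulmon (sec U)) (a + b) (ten_nu nu f) = x_ a + x_ b.
  apply/tensorP => x; rewrite coef_drop_term (coef_ten_nu _ _ hnu) !coefD !monE.
  case: (x =P a + b) => [->|_] /=; first by rewrite (negPf ab1) (negPf ab2) addr0.
  rewrite addr0; case: (x =P a) => [->|_] /=.
    rewrite a0 (negPf ab) /= !addr0; exact: nu1.
  by rewrite !add0r; case: ifP => _; rewrite ?nu1 ?nu0.
rewrite !rmorphD => E; rewrite [w (a + b) + w a]addrC.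
by rewrite [w a + _]E -addrA tadd_idem.
Qed.

End Hom.

Definition solution_val (q : set_trop_local nu (@ev_ker k X U)) :
    berkovich_affine nu U :=
  exist _ (fun a => sval q (x_ a))
    (conj (solution_semivaluation (proj2_sig q)) (solution_kinj (proj2_sig q))).

Definition val_solution (w : berkovich_affine nu U) :
    set_trop_local nu (@ev_ker k X U) :=
  exist _ (val_hom w) (val_hom_solution w).

Lemma solution_valK : cancel solution_val val_solution.
Proof.
case=> q hq; apply/eq_exist/alghom_ext => f /=.
by rewrite (hom_ten_eval q).
Qed.

Lemma val_solutionK : cancel val_solution solution_val.
Proof.
case=> w hw; apply/eq_exist/funext => a.
exact: etrans (val_hom_mon (exist _ w hw) 1 a) (mul1r _).
Qed.

Definition point_solution (q : alghom (trop_chart nu U) (alg_self T)) :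
    set_trop_local nu (@ev_ker k X U).
Proof.
pose q0 := @AlgHom T (tensor_alg (mulmon (sec U)) T) (alg_self T)
  (q \o quot_pi (bend nu (@ev_ker k X U)))
  (fun c => etrans (congr1 q (alg_funE (quot_pi (bend nu (@ev_ker k X U))) c))
     (alg_funE q c)).
by exists q0; apply: solution_bend => a b ab; congr (q _); apply/spiP.
Defined.

Lemma point_solutionE q f :
  sval (point_solution q) f = q (quot_pi (bend nu (@ev_ker k X U)) f).
Proof. by []. Qed.

Definition solution_point (q : set_trop_local nu (@ev_ker k X U)) :
    alghom (trop_chart nu U) (alg_self T) :=
  quot_lift (bend_solution (@hom_mulI (sval q)) (proj2_sig q)).

Lemma solution_pointE q f :
  solution_point q (quot_pi (bend nu (@ev_ker k X U)) f) = sval q f.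
Proof. exact: (quot_lift_pi (bend_solution (@hom_mulI (sval q)) (proj2_sig q))). Qed.

Lemma point_solutionK : cancel point_solution solution_point.
Proof.
move=> q; apply: alghom_ext => x; have [f ->] := quot_piP x.
by rewrite solution_pointE.
Qed.

Lemma solution_pointK : cancel solution_point point_solution.
Proof.
case=> q hq; apply/eq_exist/alghom_ext => f.
exact: solution_pointE.
Qed.

End SolutionValuation.

(** * Basic open sets and localizations *)

Section Localization.
Variables (A B : comPzSemiRingType) (f : A) (h : {rmorphism A -> B}).
Hypothesis loc : localization_at f h.

Lemma localization_cancel n x y : x * h f ^+ n = y * h f ^+ n -> x = y.
Proof.
have [[u uf] _ _] := loc.
move/(congr1 (fun z => z * u ^+ n)); rewrite -!mulrA -!exprMn.
by rewrite [h f * u]mulrC uf expr1n !mulr1.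
Qed.

Lemma localization_frac2 b b' :
  exists a a' n, b * h f ^+ n = h a /\ b' * h f ^+ n = h a'.
Proof.
have [_ frac _] := loc.
have [a [n ba]] := frac b; have [a' [n' ba']] := frac b'.
exists (a * f ^+ n'), (a' * f ^+ n), (n + n')%N.
rewrite !rmorphM !rmorphXn -ba -ba' -!mulrA -!exprD.
by rewrite [(n' + n)%N]addnC.
Qed.

End Localization.

Lemma prime_idealX (A : comPzRingType) (p : set A) f n :
  prime_ideal p -> ~ p f -> ~ p (f ^+ n).
Proof.
move=> [_ _ _ p1 pM] pf; elim: n => [|n IH]; first by rewrite expr0.
by rewrite exprS => /pM[].
Qed.

Section BasicOpen.
Variables (X : ringed_space) (U D : opens (pts X)) (h : D `<=` U).
Variables (phi : pts X -> set (sec U)) (f : sec U).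
Hypothesis bij : set_bij U (@prime_ideal (sec U)) phi.
Hypothesis zar : forall V : set (pts X), V `<=` U ->
  (open V <-> exists E : set (sec U),
    V = [set x | opens_set U x /\ exists2 f, E f & ~ phi x f]).
Hypothesis loc : forall (f : sec U) (V : opens (pts X)) (h : V `<=` U),
  opens_set V = [set x | opens_set U x /\ ~ phi x f] ->
  localization_at f (res h).
Hypothesis DE : opens_set D = [set x | opens_set U x /\ ~ phi x f].

Let r := res h.
Let locD : localization_at f r := loc h DE.

(** The extension of the prime [phi x] to the localization: the fractions that have a numerator in
    it. *)
Definition basic_open_prime (x : pts X) : set (sec D) :=
  [set b | exists a n, b * r f ^+ n = r a /\ phi x a].

Let psi := basic_open_prime.

Lemma D_prime x : opens_set D x ->
  [/\ opens_set U x, prime_ideal (phi x) & ~ phi x f].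
Proof.
by rewrite DE => -[Ux fx]; split=> //; case: bij => /(_ x Ux).
Qed.

(** Two numerators of [b] agree up to powers of [f], and these lie outside the prime [phi x]. *)
Lemma basic_open_primeP x b a n : opens_set D x -> b * r f ^+ n = r a ->
  psi x b <-> phi x a.
Proof.
move=> Dx ba; have [Ux px fx] := D_prime Dx.
split=> [[a' [n' [ba' xa']]]|xa]; last by exists a, n.
have : r (a * f ^+ n') = r (a' * f ^+ n).
  by rewrite !rmorphM !rmorphXn -ba -ba' mulrAC.
have [_ _ /[apply]] := locD => -[m E].
have [_ _ pI _ pM] := px.
have /pM[/(prime_idealX px fx)//|/pM[//|/(prime_idealX px fx)//]] :
  phi x (f ^+ m * (a * f ^+ n')).
by rewrite E; apply: (pI); rewrite mulrC; apply: (pI).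
Qed.

Lemma basic_open_prime_prime x : opens_set D x -> prime_ideal (psi x).
Proof.
move=> Dx; have [Ux px fx] := D_prime Dx; have [p0 pD pI p1 pM] := px.
split=> [|a b|a b||a b].
- by apply/(@basic_open_primeP x 0 0 0) => //; rewrite mul0r rmorph0.
- have [a' [b' [n [aa' bb']]]] := localization_frac2 locD a b.
  move=> /(basic_open_primeP Dx aa') xa /(basic_open_primeP Dx bb') xb.
  apply/(@basic_open_primeP x _ (a' + b') n) => //; last exact: pD.
  by rewrite mulrDl aa' bb' rmorphD.
- have [a' [b' [n [aa' bb']]]] := localization_frac2 locD a b.
  move=> /(basic_open_primeP Dx bb') xb.
  apply/(@basic_open_primeP x _ (a' * b') (n + n)) => //; last exact: pI.
  by rewrite exprD mulrACA aa' bb' rmorphM.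
- by move/(@basic_open_primeP x 1 1 0) => H; apply/p1/H => //; rewrite mul1r rmorph1.
have [a' [b' [n [aa' bb']]]] := localization_frac2 locD a b.
move/(@basic_open_primeP x _ (a' * b') (n + n)) => H.
have /pM[xa|xb] : phi x (a' * b').
  by apply: H => //; rewrite exprD mulrACA aa' bb' rmorphM.
- by left; apply/(basic_open_primeP Dx aa').
- by right; apply/(basic_open_primeP Dx bb').
Qed.

Lemma basic_open_prime_bij : set_bij D (@prime_ideal (sec D)) psi.
Proof.
have psiR x a : opens_set D x -> psi x (r a) <-> phi x a.
  by move=> Dx; apply: (@basic_open_primeP x _ a 0) => //; rewrite mulr1.
split=> [x /basic_open_prime_prime//|x y /set_mem Dx /set_mem Dy E|P PP].
  have [[Ux px fx] [Uy py fy]] := (D_prime Dx, D_prime Dy).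
  case: bij => _ inj _; apply: inj; rewrite ?inE //.
  by apply/seteqP; split=> a; rewrite -(psiR _ _ Dx) -(psiR _ _ Dy) E.
have [P0 PD PI P1 PM] := PP.
(* The point is found by contracting [P] to [sec U]; it lies in [D] because [f] becomes a unit
   there. *)
have [x Ux px] : (phi @` U) (r @^-1` P).
  case: bij => _ _; apply; split=> /= [|a b|a b||a b].
  - by rewrite rmorph0.
  - by rewrite rmorphD; apply: PD.
  - by rewrite rmorphM; apply: PI.
  - by rewrite rmorph1.
  - by rewrite rmorphM; apply: PM.
have Pf : ~ P (r f).
  by have [[u uf] _ _] := locD => /(PI u); rewrite uf.
have Dx : opens_set D x by rewrite DE; split=> //; rewrite px.
exists x => //; apply/seteqP; split=> b;
  have [_ /(_ b)[a [n ba]] _] := locD; rewrite (basic_open_primeP Dx ba) px /= -ba.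
  by move/PM => [//|/(prime_idealX PP Pf)].
by rewrite mulrC; apply: PI.
Qed.

Lemma basic_open_affine : affine D.
Proof.
have psiR x a : opens_set D x -> psi x (r a) <-> phi x a.
  by move=> Dx; apply: (@basic_open_primeP x _ a 0) => //; rewrite mulr1.
(* For a fraction [b] with numerator [a], the nonvanishing locus of [b] in [D] is that of [a * f] in
   [U]; the factor [f] cuts down to [D]. *)
have aff x a n b : b * r f ^+ n = r a ->
    (opens_set U x /\ ~ phi x (a * f)) <-> (opens_set D x /\ ~ psi x b).
  move=> ba; split=> [[Ux xaf]|[Dx xb]].
    have [_ _ pI _ _] : prime_ideal (phi x) by case: bij => /(_ x Ux).
    have Dx : opens_set D x.
      by rewrite DE; split=> // xf; apply/xaf/pI.
    split=> // /(basic_open_primeP Dx ba) xa; apply: xaf.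
    by rewrite mulrC; apply: pI.
  have [Ux px fx] := D_prime Dx; split=> //.
  have [_ _ _ _ pM] := px => /pM[|//].
  by move/(basic_open_primeP Dx ba).
exists psi; split; first exact: basic_open_prime_bij.
  move=> V VD; have VU : V `<=` U by apply: subset_trans VD h.
  rewrite zar //; split=> -[E VE].
    exists (r @` E); rewrite [LHS]VE; apply/seteqP; split=> x [].
      move=> Ux [a Ea xa].
      have Dx : opens_set D x by apply: VD; rewrite VE; split=> //; exists a.
      by split=> //; exists (r a); [exists a|rewrite psiR].
    move=> Dx [_ [a Ea <-]]; rewrite psiR // => xa.
    by have [Ux _ _] := D_prime Dx; split=> //; exists a.
  exists [set a * f | a in [set a | exists b n, E b /\ b * r f ^+ n = r a]].
  rewrite [LHS]VE; apply/seteqP; split=> x [].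
    move=> Dx [b Eb xb]; have [_ /(_ b)[a [n ba]] _] := locD.
    have [_ /(_ (conj Dx xb))[Ux xa]] := aff x a n b ba.
    by split=> //; exists (a * f) => //; exists a => //; exists b, n.
  move=> Ux [_ [a [b [n [Eb ba]]] <-] xaf].
  have [/(_ (conj Ux xaf))[Dx xb] _] := aff x a n b ba.
  by split=> //; exists b.
move=> b V hV VE; have [_ /(_ b)[a [n ba]] _] := locD.
have hU : V `<=` U by apply: subset_trans hV h.
have VUE : opens_set V = [set x | opens_set U x /\ ~ phi x (a * f)].
  by rewrite VE; apply/seteqP; split=> x /(aff x a n b ba).
have [[u uaf] fracV eqV] := loc hU VUE.
have rr c : res hV (r c) = res hU c by exact: res_comp.
(* Over [V] the elements [a * f] and [b] differ by a power of the unit [f]; the extra factor [f]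
   makes its exponent [n.+1]. *)
have rb : res hU (a * f) = res hV b * res hV (r f) ^+ n.+1.
  by rewrite rmorphM -!rr -ba rmorphM rmorphXn -mulrA exprSr.
have [[v vf] _ _] := locD.
have vfV : res hV v * res hV (r f) = 1 by rewrite -rmorphM vf rmorph1.
split.
- exists (u * res hV (r f) ^+ n.+1).
  by rewrite -uaf rb mulrAC mulrA.
- move=> s; have [c [m sc]] := fracV s.
  (* [v] inverts [f], and this power of it converts the denominator [(a * f) ^+ m] into [b ^+ m]. *)
  exists (r c * v ^+ (n.+1 * m)), m.
  rewrite rmorphM rr -sc rb rmorphXn exprMn -exprM -!mulrA; congr (_ * _).
  by rewrite -[_ ^+ (_ * m) * _]mulrC -exprMn vfV expr1n mulr1.
move=> c c' cc'.
(* With a common denominator, equality over [V] can be tested on numerators in [sec U]. *)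
have [e [e' [m [ce ce']]]] := localization_frac2 locD c c'.
have : res hU e = res hU e' by rewrite -!rr -ce -ce' !rmorphM cc'.
move/eqV => [N EN]; exists N.
have E d d' : d * r f ^+ m = r d' ->
    (b ^+ N * d) * r f ^+ (n.+1 * N + m) = r ((a * f) ^+ N * d').
  move=> dd'; rewrite exprD mulrACA dd' rmorphM rmorphXn rmorphM -ba.
  by congr (_ * _); rewrite exprM -exprMn exprSr mulrA.
apply: (localization_cancel locD (n := n.+1 * N + m)).
by rewrite (E c e) // (E c' e') // EN.
Qed.

End BasicOpen.

(** * Extension of points and semivaluations to a localization *)

Section ExtendToLocalization.
Variables (A B S : comPzSemiRingType) (f : A) (h : {rmorphism A -> B}).
Hypothesis loc : localization_at f h.
Variables (w : A -> S) (y : S).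
Hypotheses (w1 : w 1 = 1) (wM : forall a b, w (a * b) = w a * w b).
Hypothesis wf : w f * y = 1.

(** Stated for multiplicative maps so as to serve both algebra maps and semivaluations; their
    additive laws are checked afterwards on a common denominator. *)
Lemma loc_extend_subproof b : exists s, forall a n,
  b * h f ^+ n = h a -> s = w a * y ^+ n.
Proof.
have wX n : w (f ^+ n) = w f ^+ n.
  by elim: n => [|n IH]; rewrite ?expr0 // !exprS wM IH.
have wfX n : w f ^+ n * y ^+ n = 1 by rewrite -exprMn wf expr1n.
have [_ /(_ b)[a [n ba]] eqB] := loc.
exists (w a * y ^+ n) => a' n' ba'.
have /eqB[m] : h (a * f ^+ n') = h (a' * f ^+ n).
  by rewrite !rmorphM !rmorphXn -ba -ba' mulrAC.
move/(congr1 w); rewrite !wM !wX => /(congr1 (fun s => y ^+ m * s)).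
rewrite !mulrA ![y ^+ m * _]mulrC !wfX !mul1r => E.
by rewrite -[LHS]mulr1 -(wfX n') mulrACA E mulrA -(mulrA (w a')) wfX mulr1.
Qed.

Definition loc_extend b : S := projT1 (cid (loc_extend_subproof b)).

Lemma loc_extend_frac b a n : b * h f ^+ n = h a -> loc_extend b = w a * y ^+ n.
Proof. exact: (projT2 (cid (loc_extend_subproof b))). Qed.

Lemma loc_extendE a : loc_extend (h a) = w a.
Proof. by rewrite (@loc_extend_frac _ a 0) ?mulr1. Qed.

Lemma loc_extendM b b' : loc_extend (b * b') = loc_extend b * loc_extend b'.
Proof.
have [a [a' [n [ba ba']]]] := localization_frac2 loc b b'.
rewrite (loc_extend_frac ba) (loc_extend_frac ba').
rewrite (@loc_extend_frac _ (a * a') (n + n)) ?wM ?exprD; first exact: mulrACA.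
by rewrite mulrACA ba ba' rmorphM.
Qed.

Lemma loc_extend1 : loc_extend 1 = 1.
Proof. by rewrite -(rmorph1 h) loc_extendE. Qed.

End ExtendToLocalization.

Lemma alghom_extend (S : comPzSemiRingType) (A B : alg S) (f : A)
    (h : alghom A B) (q : alghom A (alg_self S)) (y : S) :
  localization_at f h -> (q f : S) * y = 1 ->
  exists q' : alghom B (alg_self S), forall a, q' (h a) = q a.
Proof.
move=> loc qf; pose e := loc_extend loc (rmorph1 q) (rmorphM q) qf.
have eE a : e (h a) = q a by exact: loc_extendE.
have e_nmod : nmod_morphism (e : B -> alg_self S).
  split=> [|b b']; first by rewrite -(rmorph0 h) eE rmorph0.
  have [a [a' [n [ba ba']]]] := localization_frac2 loc b b'.
  rewrite /e (loc_extend_frac _ _ _ _ ba) (loc_extend_frac _ _ _ _ ba').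
  rewrite (@loc_extend_frac _ _ _ _ _ loc _ _ _ _ _ _ (a + a') n).
    by rewrite rmorphD mulrDl.
  by rewrite mulrDl ba ba' rmorphD.
have e_monoid : monoid_morphism (e : B -> alg_self S).
  by split=> [|b b']; [exact: loc_extend1|exact: loc_extendM].
pose e1 := GRing.isNmodMorphism.Build _ _ (e : B -> alg_self S) e_nmod.
pose e2 := GRing.isMonoidMorphism.Build _ _ (e : B -> alg_self S) e_monoid.
pose er : {rmorphism B -> alg_self S} := HB.pack (e : B -> alg_self S) e1 e2.
have ec c : er (alg_str B c) = alg_str (alg_self S) c.
  by rewrite -(alg_funE h) [LHS]eE alg_funE.
by exists (AlgHom ec).
Qed.

Lemma semivaluation_extend (R : realType) (A B : comPzRingType) (f : A)
    (h : {rmorphism A -> B}) (w : A -> trop R) :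
  localization_at f h -> semivaluation w -> w f <> 0 ->
  exists w' : B -> trop R, semivaluation w' /\ forall a, w' (h a) = w a.
Proof.
move=> loc [w0 [w1 wN1] wM wD] /tmul_inv[y wf].
rewrite mulrC in wf; pose e := loc_extend loc w1 wM wf.
have eE a : e (h a) = w a by exact: loc_extendE.
exists e; split=> //; split=> [|||b b'].
- by rewrite -(rmorph0 h) eE.
- by rewrite -(rmorph1 h) -rmorphN !eE.
- exact: loc_extendM.
have [a [a' [n [ba ba']]]] := localization_frac2 loc b b'.
rewrite /e (loc_extend_frac _ _ _ _ ba) (loc_extend_frac _ _ _ _ ba').
rewrite (@loc_extend_frac _ _ _ _ _ loc _ _ _ _ _ _ (a + a') n).
  by rewrite -!mulrDl wD.
by rewrite mulrDl ba ba' rmorphD.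
Qed.

Lemma semivaluation_support_prime (R : realType) (A : comPzRingType)
    (w : A -> trop R) : semivaluation w -> prime_ideal [set a | w a = 0].
Proof.
move=> [w0 [w1 _] wM wD]; split=> //= [a b wa wb|a b wb||a b].
- by have := wD a b; rewrite wa wb !addr0.
- by rewrite wM wb mulr0.
- by rewrite w1; exact: trop_one_neq0.
- by rewrite wM => /tmul_eq0.
Qed.

Section ValuationNearSupport.
Variables (R : realType) (k : fieldType) (nu : k -> trop R) (X : scheme k).
Variables (U V : affine_open X) (h : V `<=` U).

(* The support of [w] is a point of V; a basic open neighbourhood of it in U
   contained in V is one on which [w] is still defined. *)
Lemma berkovich_shrink (w : berkovich_affine nu V) :
  exists (D : affine_open X) (hU : D `<=` U) (hV : D `<=` V) (f : sec U)
    (w' : berkovich_affine nu D),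
    localization_at f (res hU) /\ forall a, sval w' (res hV a) = sval w a.
Proof.
have [wsv wk] := proj2_sig w.
have [phi [bijU zarU locU]] := proj2_sig U.
have [psi [bijV zarV locV]] := proj2_sig V.
have [x Vx px] : (psi @` V) [set a | sval w a = 0].
  by case: bijV => _ _; apply; exact: semivaluation_support_prime.
have [E VE] := (zarU V h).1 (proj2_sig (affine_opens V)).
(* [f] cuts out a basic open set of [U] that contains [x] and lies in [V]. *)
have [f Ef fx] : exists2 f, E f & ~ phi x f.
  by move: (Vx); rewrite [X in X x -> _]VE => -[].
pose D0 := [set y | opens_set U y /\ ~ phi y f].
have D0U : D0 `<=` U by move=> y [].
have D0V : D0 `<=` V by move=> y [Uy fy]; rewrite VE; split=> //; exists f.
have oD0 : open D0.
  by apply/(zarU D0 D0U); exists [set f]; apply/seteqP; split=> y [Uy];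
    [move=> fy; split=> //; exists f|move=> [g -> gy]].
pose D1 : opens (pts X) := exist _ D0 oD0.
have affD : affine D1 by exact: (@basic_open_affine X U D1 D0U phi f bijU zarU locU).
pose D : affine_open X := exist _ D1 affD.
(* [D] is basic in [U], while [w] lives on [V]. So a basic open set of [V] around [x] inside [D] is
   chosen; [w] extends to it and is then pulled back to [D]. *)
have [E' D0E] := (zarV D0 D0V).1 oD0.
have D0x : D0 x by split=> //; exact: h.
have [g E'g gx] : exists2 g, E' g & ~ psi x g.
  by move: (D0x); rewrite [X in X x -> _]D0E => -[].
pose D' := [set y | opens_set V y /\ ~ psi y g].
have D'V : D' `<=` V by move=> y [].
have oD' : open D'.
  by apply/(zarV D' D'V); exists [set g]; apply/seteqP; split=> y [Vy];
    [move=> fy; split=> //; exists g|move=> [g' -> gy]].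
pose D1' : opens (pts X) := exist _ D' oD'.
have D'D : D1' `<=` D1 by move=> y [Vy gy] /=; rewrite D0E; split=> //; exists g.
have [w' [w'sv w'E]] : exists w' : sec D1' -> trop R, semivaluation w' /\
    forall a, w' (res (D'V : D1' `<=` V) a) = sval w a.
  apply: (semivaluation_extend (f := g)) => //; first exact: locV.
  by rewrite px in gx.
have wD : semivaluation (fun a : sec D => w' (res D'D a)) /\
    forall c, w' (res D'D (kinj D c)) = nu c.
  case: w'sv => w'0 [w'1 w'N1] w'M w'D; split=> [|c].
    split=> [|||a b]; rewrite ?rmorph0 ?rmorph1 ?rmorphN ?rmorphD //.
      by rewrite rmorph1.
    by move=> a b; rewrite rmorphM.
  have D'X : opens_set D1' `<=` opens_full (pts X) by [].
  rewrite -wk -w'E; congr w'.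
  exact: etrans (res_comp _ _ D'X _) (esym (res_comp _ _ D'X _)).
pose w'' : berkovich_affine nu D := exist _ (fun a : sec D => w' (res D'D a)) wD.
exists D, D0U, D0V, f, w''; split=> [|a /=]; first exact: locU.
by rewrite -w'E; congr w'; exact: res_comp.
Qed.

End ValuationNearSupport.

Section TensorUnits.
Variables (A : comPzRingType) (S : comPzSemiRingType).
Implicit Types (f : tensor (mulmon A) S) (b u : A).
Local Notation x_ b := (@mon (mulmon A) S 1 b).

Lemma monX b n : x_ b ^+ n = x_ (b ^+ n).
Proof.
elim: n => [|n IH]; first by rewrite !expr0.
by rewrite !exprS IH mulmon_mon mulr1.
Qed.

(** Multiplication by the monomial of a unit permutes the monomials. *)
Lemma coef_mul_unit f b u c : u * b = 1 ->
  coef (f * x_ b) (c : mulmon A) = coef f (c * u).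
Proof.
move=> ub; elim/tensor_ind: f => [|f f' Hf Hf'|e a].
- by rewrite mul0r !coefZ0.
- by rewrite mulrDl !coefD Hf Hf'.
rewrite mulmon_mon mulr1 !monE /=.
have cbu (a' : A) : (c == a' * b) = (c * u == a').
  apply/eqP/eqP => [->|<-]; first by rewrite -mulrA [b * u]mulrC ub mulr1.
  by rewrite -mulrA ub mulr1.
by rewrite [c == _]cbu; have := cbu 0; rewrite mul0r => ->.
Qed.

End TensorUnits.

Lemma tmap_inj (S : comPzSemiRingType) (B B' : f1alg) (phi : f1hom B B') :
  injective phi -> injective (@tmap S B B' phi).
Proof.
by move=> phiI f g fg; apply/tensorP => b; rewrite -!(tmap_coef _ _ phiI) fg.
Qed.

Lemma tmap_drop_term (S : comPzSemiRingType) (B B' : f1alg) (phi : f1hom B B')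
    b (f : tensor B S) : injective phi ->
  tmap phi (drop_term b f) = drop_term (phi b) (tmap phi f).
Proof.
move=> phiI; elim/tensor_ind: f => [|f f' Hf Hf'|c a].
- by rewrite !raddf0.
- by rewrite !raddfD /= Hf Hf'.
rewrite drop_term_mon tmap_mon drop_term_mon (inj_eq phiI).
by case: ifP => _; rewrite ?tmap_mon ?raddf0.
Qed.

(** * Localization of the bend congruence *)

Section TropLocalization.
Variables (R : realType) (k : fieldType) (nu : k -> trop R) (X : scheme k).
Hypotheses (hnu : semivaluation nu) (hX : integral_scheme X).
Variables (U D : affine_open X) (h : D `<=` U) (f : sec U).
Hypothesis loc : localization_at f (res h).
Hypothesis D0 : opens_set D !=set0.

Let r := res h.
Let rI : injective (mulmon_hom r) := @res_injective k X hX U D h D0.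
Let T := trop R.
Local Notation TU S := (tensor (mulmon (sec U)) S).
Local Notation TD S := (tensor (mulmon (sec D)) S).
Local Notation hat := (tmap (mulmon_hom r)).
Local Notation x_ S := (@mon (mulmon (sec U)) S 1 f).

Lemma hat_x S n : hat (x_ S) ^+ n = @mon (mulmon (sec D)) S 1 (r f ^+ n).
Proof. by rewrite tmap_mon monX. Qed.

Lemma hat_x_unit S n : exists v : TD S, v * hat (x_ S) ^+ n = 1.
Proof.
have [[v vf] _ _] := loc.
exists (@mon (mulmon (sec D)) S 1 (v ^+ n)); rewrite hat_x mulmon_mon mulr1 /= -exprMn.
by rewrite vf expr1n.
Qed.

Lemma hat_frac S (g : TD S) : exists n G, g * hat (x_ S) ^+ n = hat G.
Proof.
elim/tensor_ind: g => [|g g' [n [G E]] [n' [G' E']]|c b].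
- by exists 0%N, 0; rewrite mul0r raddf0.
- exists (n + n')%N, (G * x_ S ^+ n' + G' * x_ S ^+ n).
  rewrite rmorphD !rmorphM /= -E -E' !rmorphXn /= mulrDl -!mulrA -!exprD.
  by rewrite [(n' + n)%N]addnC.
have [_ /(_ b)[a [n ba]] _] := loc; exists n, (@mon (mulmon (sec U)) S c a).
by rewrite hat_x mulmon_mon mulr1 tmap_mon /= -ba.
Qed.

Lemma ev_mul_mon (W : affine_open X) (F : tensor (mulmon (sec W)) k) (b : sec W) :
  ev (F * @mon (mulmon (sec W)) k 1 b) = ev F * b.
Proof.
elim/tensor_ind: F => [|F F' HF HF'|c a].
- by rewrite mul0r /ev !term_sum0 mul0r.
- by rewrite mulrDl !evD HF HF' mulrDl.
by rewrite mulmon_mon !ev_mon mulr1 mulrA.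
Qed.

(** No two terms merge under multiplication by the monomial of a unit, so valuing the coefficients
    commutes with it. *)
Lemma ten_nu_mul_unit (F : TD k) (b u : sec D) : u * b = 1 ->
  ten_nu nu (F * @mon (mulmon (sec D)) k 1 b) =
  ten_nu nu F * @mon (mulmon (sec D)) T 1 b.
Proof.
move=> ub; apply/tensorP => c.
by rewrite (coef_mul_unit _ _ ub) !(coef_ten_nu _ _ hnu) (coef_mul_unit _ _ ub).
Qed.

(** Elements with such a numerator form an ideal. For a generator, clearing the denominators of [F]
    gives an element of the kernel over [U], because restriction is injective. *)
Lemma trop_ideal_frac (g : TD T) : trop_ideal nu (@ev_ker k X D) g ->
  exists n G, trop_ideal nu (@ev_ker k X U) G /\ g * hat (x_ T) ^+ n = hat G.
Proof.
pose J : set (TD T) := [set g | exists n G,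
  trop_ideal nu (@ev_ker k X U) G /\ g * hat (x_ T) ^+ n = hat G].
apply: (_ : _ -> J g); apply.
  split=> [|a b [n [G [GI E]]] [n' [G' [GI' E']]]|a b [n [G [GI E]]]].
  - exists 0%N, 0; rewrite mul0r raddf0; split=> //.
    by move=> K [].
  - exists (n + n')%N, (x_ T ^+ n' * G + x_ T ^+ n * G'); split.
      move=> K KI KF; have [_ KD KM] := KI.
      by apply/KD; apply/KM; [apply: GI|apply: GI'].
    rewrite rmorphD !rmorphM /= -E -E' !rmorphXn /= mulrDl exprD.
    by rewrite mulrA [X in _ + X]mulrCA [X in _ = X + _]mulrC mulrA.
  have [m [A EA]] := hat_frac a.
  exists (m + n)%N, (A * G); split.
    by move=> K KI KF; have [_ _ KM] := KI; apply/KM; apply: GI.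
  by rewrite rmorphM /= -E -EA exprD mulrACA.
move=> F F0; have [n [F' E]] := hat_frac F.
exists n, (ten_nu nu F'); split.
  move=> K _; apply; apply: (@res_injective k X hX U D h D0).
  rewrite rmorph0 -ev_hat_res -[hat_res h F']E hat_x ev_mul_mon.
  by rewrite [ev F]F0 mul0r.
rewrite -ten_nu_tmap // -E !hat_x.
have [[v vf] _ _] := loc.
by apply/esym/(@ten_nu_mul_unit _ _ (v ^+ n)); rewrite -exprMn vf expr1n.
Qed.

(** The localization at [x_f] of the bend congruence of [U]. *)
Let frac_rel (s t : TD T) : Prop := exists n a b,
  [/\ s * hat (x_ T) ^+ n = hat a, t * hat (x_ T) ^+ n = hat b
    & bend nu (@ev_ker k X U) a b].

Lemma hat_mulX s n (a : TU T) m : s * hat (x_ T) ^+ n = hat a ->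
  s * hat (x_ T) ^+ (n + m) = hat (a * x_ T ^+ m).
Proof. by move=> E; rewrite exprD mulrA E rmorphM rmorphXn. Qed.

Lemma frac_rel_trans t s u : frac_rel s t -> frac_rel t u -> frac_rel s u.
Proof.
move=> [n [a [b [sa tb ab]]]] [m [b' [c [tb' uc bc]]]].
exists (n + m)%N, (a * x_ T ^+ m), (c * x_ T ^+ n).
split; first exact: hat_mulX.
  by rewrite addnC; exact: hat_mulX.
apply: (@cong_trans _ _ (b * x_ T ^+ m)).
  by apply: congM => //; exact: cong_refl.
(* Injectivity of [hat] identifies the two numerators of the middle term. *)
have -> : b * x_ T ^+ m = b' * x_ T ^+ n.
  apply: (tmap_inj rI); rewrite -(hat_mulX m tb) -(hat_mulX n tb').
  by rewrite addnC.
by apply: congM => //; exact: cong_refl.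
Qed.

Definition frac_cong : congruence (tensor_alg (mulmon (sec D)) T).
Proof.
apply: (@Congruence (tensor_alg (mulmon (sec D)) T) frac_rel).
- move=> s; have [n [a E]] := hat_frac s.
  by exists n, a, a; split=> //; exact: cong_refl.
- by move=> s t [n [a [b [sa tb ab]]]]; exists n, b, a; split=> //; exact: cong_sym.
- exact: frac_rel_trans.
- move=> s t s' t' [n [a [b [sa tb ab]]]] [m [a' [b' [sa' tb' ab']]]].
  exists (n + m)%N, (a * x_ T ^+ m + a' * x_ T ^+ n), (b * x_ T ^+ m + b' * x_ T ^+ n).
  split.
  + by rewrite rmorphD mulrDl /= (hat_mulX m sa) [(n + m)%N]addnC (hat_mulX n sa').
  + by rewrite rmorphD mulrDl /= (hat_mulX m tb) [(n + m)%N]addnC (hat_mulX n tb').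
  + by apply: congD; apply: congM => //; exact: cong_refl.
move=> s t s' t' [n [a [b [sa tb ab]]]] [m [a' [b' [sa' tb' ab']]]].
exists (n + m)%N, (a * a'), (b * b'); split; last exact: congM.
+ by rewrite exprD mulrACA sa sa' rmorphM.
+ by rewrite exprD mulrACA tb tb' rmorphM.
Defined.

(** As [frac_rel] is a congruence, only the generating bend relations over [D] matter; after
    clearing denominators each becomes a bend relation over [U]. *)
Lemma bend_frac s t : bend nu (@ev_ker k X D) s t -> frac_rel s t.
Proof.
move/(_ frac_cong); apply => g g' [/trop_ideal_frac[n [G [GI E]]]].
move=> /term_deletedP[b bg ->].
have [[v vf] _ _] := loc.
have vfn : v ^+ n * r f ^+ n = 1 by rewrite -exprMn vf expr1n.
have coefE : coef (hat G) (b * r f ^+ n) = coef g b.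
  rewrite -E hat_x (coef_mul_unit _ _ vfn).
  by rewrite -mulrA [_ * v ^+ n]mulrC vfn mulr1.
(* The coefficient of [hat G] at this monomial is nonzero, so the monomial comes from [U]. *)
have [a ab] : exists a, r a = b * r f ^+ n.
  apply: contrapT => na; move: bg; rewrite mem_finsupp -coefE.
  by rewrite tmap_coefN ?eqxx // => a ab; apply: na; exists a.
exists n, G, (drop_term (B := mulmon (sec U)) a G); split=> //.
  rewrite tmap_drop_term // -E hat_x /= ab.
  rewrite [_ * mon _ _]mulrC [_ * mon _ _]mulrC [b * _]mulrC.
  rewrite -(@drop_term_mulmon (mulmon (sec D)) T (r f ^+ n) b 1) //.
  by move=> c c' /= /(congr1 (fun c => v ^+ n * c)); rewrite !mulrA vfn !mul1r.
move=> K; apply; split=> //; apply/term_deletedP; exists a => //.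
by rewrite mem_finsupp -(tmap_coef _ _ rI) /= ab coefE -mem_finsupp.
Qed.

Lemma trop_res_localization :
  localization_at (quot_pi (bend nu (@ev_ker k X U)) (x_ T)) (trop_res nu hX h).
Proof.
split.
- have [v vx] := hat_x_unit T 1; exists (quot_pi (bend nu (@ev_ker k X D)) v).
  rewrite trop_res_pi -rmorphM [v * _](_ : _ = 1) ?rmorph1 //.
- move=> y; have [g ->] := quot_piP y; have [n [G E]] := hat_frac g.
  exists (quot_pi (bend nu (@ev_ker k X U)) G), n.
  by rewrite !trop_res_pi -rmorphXn -rmorphM; congr (quot_pi _ _).
move=> y y'; have [a ->] := quot_piP y; have [a' ->] := quot_piP y'.
rewrite !trop_res_pi => /spiP/bend_frac[n [b [b' [ab ab' bb']]]].
have hatE c d : hat c * hat (x_ T) ^+ n = hat d -> d = x_ T ^+ n * c.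
  by move=> E; apply: (tmap_inj rI); rewrite -E mulrC rmorphM rmorphXn.
exists n; rewrite -!rmorphXn -!rmorphM; apply/spiP.
by rewrite -(hatE _ _ ab) -(hatE _ _ ab').
Qed.

End TropLocalization.

(** * The topology of an affine chart *)

Section AffineTopology.
Variables (R : realType) (k : fieldType) (nu : k -> trop R) (X : scheme k).
Variable U : affine_open X.
Let T := trop R.
Local Notation A := (tensor (mulmon (sec U)) T).
Implicit Types (w : berkovich_affine nu U) (s t : A).

Lemma val_continuous (a : sec U) :
  continuous (fun w : berkovich_affine nu U => sval w a).
Proof.
move=> w.
have h := (@cvg_sup (berkovich_affine nu U) _ (fun a : sec U => Topological.class
  (initial_topology (fun w : berkovich_affine nu U => sval w a))) (nbhs w) w _).1
  (fun _ => id) a.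
by move=> V /(@initial_continuous _ _ (fun w : berkovich_affine nu U => sval w a) w) /h.
Qed.

Lemma expN_continuous : continuous (@expN R : trop R -> R).
Proof. exact: (@initial_continuous (trop R) R (@expN R)). Qed.

(** Through [expN] a tropical polynomial becomes a maximum of constants times coordinates, so
    continuity can be checked in [R]. *)
Lemma expN_val_hom_continuous s :
  continuous (fun w => expN (val_hom w s) : R).
Proof.
elim/tensor_ind: s => [|s t Hs Ht|c a].
- have -> : (fun w => expN (val_hom w 0) : R) = fun=> 0.
    by apply/funext => w; rewrite rmorph0.
  exact: cst_continuous.
- have -> : (fun w => expN (val_hom w (s + t)) : R) =
      (fun w => expN (val_hom w s)) \max (fun w => expN (val_hom w t)).
    by apply/funext => w; rewrite rmorphD expND.
  by move=> w; apply: continuous_max; [exact: Hs|exact: Ht].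
have -> : (fun w => expN (val_hom w (@mon (mulmon (sec U)) T c a)) : R) =
    (fun=> expN c) \* (@expN R \o (fun w => sval w a)).
  by apply/funext => w; rewrite val_hom_mon expNM.
move=> w; apply: continuousM; first exact: cst_continuous.
apply: (@continuous_comp _ _ _ (fun w => sval w a) (@expN R)).
  exact: val_continuous.
exact: expN_continuous.
Qed.

Lemma closed_val_hom_eq s t :
  closed [set w : berkovich_affine nu U | val_hom w s = val_hom w t :> T].
Proof.
rewrite (_ : mkset _ =
    ((fun w => expN (val_hom w s)) - (fun w => expN (val_hom w t)) :
       berkovich_affine nu U -> R) @^-1` [set 0]).
  apply: preimage_closed;
    last exact/accessible_closed_set1/hausdorff_accessible/Rhausdorff.
  move=> w _; apply: continuousB; exact: expN_val_hom_continuous.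
apply/seteqP; split=> w E.
  change (expN (val_hom w s) - expN (val_hom w t) = 0).
  by apply/eqP; rewrite subr_eq0; apply/eqP; congr expN.
have /eqP : expN (val_hom w s) - expN (val_hom w t) = 0 by exact: E.
by rewrite subr_eq0 => /eqP/expN_inj.
Qed.

(** An algebraic form of being a neighbourhood: the complement of the locus of one equation contains
    [w] and lies in [W]. *)
Definition separated_at w (W : set (berkovich_affine nu U)) : Prop :=
  exists s t, val_hom w s <> val_hom w t :> T /\
    forall w', ~ W w' -> val_hom w' s = val_hom w' t :> T.

Lemma separated_atI w W W' :
  separated_at w W -> separated_at w W' -> separated_at w (W `&` W').
Proof.
move=> [s [t [st hW]]] [s' [t' [st' hW']]].
exists (s * s' + t * t'), (s * t' + t * s'); rewrite !rmorphD !rmorphM.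
split=> [/twisted_eq[]//|w' nW]; rewrite !rmorphD !rmorphM; apply/twisted_eq.
have [/hW|/contrapT Ww'] := pselect (~ W w'); first by left.
by right; apply: hW' => W'w'; apply: nW.
Qed.

Lemma separated_at_sub w W W' : W `<=` W' -> separated_at w W -> separated_at w W'.
Proof.
move=> WW' [s [t [st hW]]]; exists s, t; split=> // w' nW'.
by apply: hW => /WW'.
Qed.

Lemma separated_at_bigcap w (r : seq (set (berkovich_affine nu U))) :
  (forall W, W \in r -> separated_at w W) ->
  separated_at w [set w' | forall W, W \in r -> W w'].
Proof.
elim: r => [|W r IH] h.
  exists 1, 0; split=> [|w' []//]; rewrite rmorph1 rmorph0.
  exact: trop_one_neq0.
apply: separated_at_sub (separated_atI (h W (mem_head _ _)) (IH _)).
  by move=> w' [Ww' hr] W'; rewrite inE => /orP[/eqP->//|/hr].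
by move=> W' W'r; apply: h; rewrite inE W'r orbT.
Qed.

Lemma separated_at_preimage w (a : sec U) (O : set R) : open O ->
  O (expN (sval w a)) ->
  separated_at w [set w' : berkovich_affine nu U | O (expN (sval w' a))].
Proof.
move=> oO Ow; set y := expN (sval w a).
have y0 : 0 <= y by exact: expN_ge0.
have := (@nbhs_ballP R R y O).1 (open_nbhs_nbhs (conj oO Ow)) => -[e /= e0 ballO].
pose x : A := @mon (mulmon (sec U)) T 1 a.
have xE w' : val_hom w' x = sval w' a by rewrite val_hom_mon mul1r.
have cE w' c : val_hom w' (ten_cst (mulmon (sec U)) c) = c.
  exact: (alg_funE (val_hom w') c).
have [u uE] : exists u : T, expN u = y + e by apply/expN_surj/addr_ge0/ltW.
(* The equation [x + u = x] holds exactly where the coordinate, seen through [expN], is at least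
   [y + e]. *)
have upper : separated_at w [set w' | expN (sval w' a) < y + e].
  exists (x + ten_cst _ u), x; rewrite rmorphD xE [val_hom w (ten_cst _ _)]cE; split.
    move/(congr1 (@expN R)); rewrite expND uE => /max_idPl.
    by rewrite -/y leNgt ltrDl e0.
  move=> w' /negP; rewrite -leNgt => h; rewrite rmorphD xE [val_hom w' (ten_cst _ _)]cE.
  by apply: expN_inj; rewrite expND uE; apply/max_idPl.
(* At [y = 0] the upper bound alone suffices, since [expN] is nonnegative. *)
have [y00|y00] := eqVneq y 0.
  apply: separated_at_sub upper => w' /= h; apply: ballO.
  by rewrite /ball /= y00 sub0r normrN ger0_norm ?expN_ge0 // -[e]add0r -y00.
have yp : 0 < y by rewrite lt_def y00.
(* The lower bound is truncated at 0 to be a value of [expN]. *)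
have [l lE] : exists l : T, expN l = Num.max 0 (y - e).
  by apply: expN_surj; rewrite le_max lexx.
have ly : expN l < y by rewrite lE gt_max yp ltrBlDr ltrDl.
have lower : separated_at w [set w' | expN l < expN (sval w' a)].
  exists (x + ten_cst _ l), (ten_cst _ l).
  rewrite rmorphD xE [val_hom w (ten_cst _ _)]cE; split.
    move/(congr1 (@expN R)); rewrite expND => /max_idPr.
    by rewrite leNgt ly.
  move=> w' /negP; rewrite -leNgt => h.
  rewrite rmorphD xE [val_hom w' (ten_cst _ _)]cE.
  by apply: expN_inj; rewrite expND; apply/max_idPr.
apply: separated_at_sub (separated_atI upper lower) => w' /= [h1 h2].
apply: ballO; rewrite /ball /= distrC ltr_distl h1 andbT.
by apply: le_lt_trans h2; rewrite lE le_max lexx orbT.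
Qed.

Lemma open_separated W w : open W -> W w -> separated_at w W.
Proof.
(* Unfolding the supremum topology: [C] is an intersection, over the finite family [D], of preimages
   of open sets under coordinates. *)
move=> [B sB BW]; rewrite -BW => -[C BC Cw].
have [D sD DC] := sB C BC.
pose D' : {fset set (berkovich_affine nu U)} := D.
have {}DC w' : (forall E, E \in D' -> E w') <-> (C : set (berkovich_affine nu U)) w'.
  by rewrite -[C](DC : \bigcap_(E in [set` D']) E = C).
apply: (@separated_at_sub _ [set w' | forall E, E \in (D' : seq _) -> E w']).
  by move=> w' h; exists C => //; exact/DC.
apply: separated_at_bigcap => E ED.
have := sD E ED; rewrite inE => -[a _ [V [V' oV' VE] EV]].
have := (DC w).2 Cw E ED; rewrite -EV -VE.
exact: separated_at_preimage.
Qed.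

End AffineTopology.

(** * Gluing *)

Section Gluing.
Variables (R : realType) (k : fieldType) (nu : k -> trop R) (X : scheme k).
Hypotheses (hnu : semivaluation nu) (hX : integral_scheme X).
Let T := trop R.
Local Notation tpi U := (quot_pi (bend nu (@ev_ker k X U))).
Local Notation point := (@point_class T (trop_univ nu hX) _).

Lemma val_hom_res (U V : affine_open X) (h : V `<=` U)
    (w : berkovich_affine nu U) (w' : berkovich_affine nu V) :
  (forall a, sval w a = sval w' (res h a)) ->
  forall g, val_hom w g = val_hom w' (hat_res h g) :> T.
Proof.
move=> ww' g; elim/tensor_ind: g => [|g g' Hg Hg'|c a].
- by rewrite /hat_res !raddf0.
- by rewrite /hat_res !raddfD; congr (_ + _).
by rewrite /hat_res tmap_mon !val_hom_mon ww'.
Qed.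

Section Chart.
Variable U : affine_open X.

Definition val_point (w : berkovich_affine nu U) :
    alghom (trop_chart nu U) (alg_self T) :=
  solution_point hX (val_solution w).

Lemma val_pointE w g : val_point w (tpi U g) = val_hom w g.
Proof. exact: solution_pointE. Qed.

Lemma val_point_surj q : exists w, q = val_point w.
Proof.
exists (solution_val hnu (point_solution q)).
by rewrite /val_point solution_valK point_solutionK.
Qed.

End Chart.

Lemma val_point_res (U V : affine_open X) (h : V `<=` U) w w' :
  (forall a, sval w a = sval w' (res h a)) ->
  forall s, val_point w s = val_point w' (trop_res nu hX h s) :> T.
Proof.
move=> ww' s; have [g ->] := quot_piP s.
by rewrite trop_res_pi !val_pointE; exact: val_hom_res.
Qed.

Section ClosedSubscheme.
Variable Z : closed_subscheme (trop_univ nu hX).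

Definition factors_through (p : point_pre (trop_univ nu hX)) : Prop :=
  forall s t, Z (tag p) s t -> tagged p s = tagged p t.

(** One direction is [cs_res]. For the other, [q] is viewed on a basic open set of [U] inside [V],
    where by [cs_qc] the congruence of [Z] is generated by the one on [U]. *)
Lemma factors_through_res (U V : affine_open X) (h : V `<=` U)
    (q : alghom (trop_chart nu V) (alg_self T))
    (q' : alghom (trop_chart nu U) (alg_self T)) :
  (forall s, q' s = q (trop_res nu hX h s) :> T) ->
  (forall s t, Z V s t -> q s = q t) <-> (forall s t, Z U s t -> q' s = q' t).
Proof.
move=> E; split=> Zq s t.
  by move=> /(@cs_res _ _ Z U V h s t)/Zq qst; rewrite !E.
have [w qE] := val_point_surj q.
have [D [hU [hV [f [w' [loc ww']]]]]] := berkovich_shrink h w.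
have D0 : opens_set D !=set0 by exact: hom_inhabited (val_hom w').
have qD s' : q s' = val_point w' (trop_res nu hX hV s').
  by rewrite qE; apply: val_point_res => a; rewrite ww'.
move=> /(@cs_res _ _ Z V D hV s t).
move/(@cs_qc _ _ Z U D hU _ (trop_res_localization hnu hX loc D0)).
rewrite [RHS]qD [LHS]qD => /(_ (hom_ker (val_point w'))).
apply => _ _ [a [b [ab -> ->]]].
have := Zq a b ab; rewrite [RHS]E [LHS]E !qD.
rewrite !(@trop_res_comp R k nu X hX U V D h hV hU).
exact.
Qed.

Lemma factors_through_step p p' : point_step p p' ->
  factors_through p <-> factors_through p'.
Proof. by case: p p' => V q [U q'] [h E]; exact: (@factors_through_res U V h). Qed.

(** [cs_points] asks for some representative; invariance along the steps allows any given one. *)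
Lemma cs_pointsP (U : affine_open X) (q : alghom (trop_chart nu U) (alg_self T)) :
  cs_points Z (point q) <-> forall s t, Z U s t -> q s = q t.
Proof.
split=> [[V [q' [/clsP pq Zq']]]|Zq]; last by exists U, q.
suff E p p' : clos_refl_sym_trans _ (@point_step _ (trop_univ nu hX)) p p' ->
    factors_through p <-> factors_through p'.
  exact: (E _ _ pq).2 Zq'.
elim=> [x y|//|x y _|x y z _ H1 _ H2]; first exact: factors_through_step.
  by move->.
by rewrite H1.
Qed.

End ClosedSubscheme.

(** * Closed subschemes from sets of points *)

Section CongruenceOfSet.
Variable C : set (points (trop_univ nu hX)).

Definition vanishing_cong (U : affine_open X) : congruence (trop_chart nu U).
Proof.
apply: (@Congruence (trop_chart nu U) (fun s t =>
  forall q : alghom (trop_chart nu U) (alg_self T), C (point q) -> q s = q t)).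
- by [].
- by move=> s t st q Cq; rewrite st.
- by move=> s t u st su q Cq; rewrite st // su.
- by move=> s t s' t' st st' q Cq; rewrite !rmorphD st // st'.
- by move=> s t s' t' st st' q Cq; rewrite !rmorphM st // st'.
Defined.

Definition hom_comp (A B D : alg T) (g : alghom B D) (h : alghom A B) : alghom A D :=
  @AlgHom T A D (g \o h)
    (fun c => etrans (congr1 g (alg_funE h c)) (alg_funE g c)).

Lemma point_res (U V : affine_open X) (h : V `<=` U)
    (q : alghom (trop_chart nu V) (alg_self T))
    (q' : alghom (trop_chart nu U) (alg_self T)) :
  (forall s, q (trop_res nu hX h s) = q' s) -> point q = point q'.
Proof. by move=> qq'; apply/clsP/rst_step; exists h => s /=; rewrite -qq'. Qed.

Lemma vanishing_cong_res (U V : affine_open X) (h : V `<=` U) s t :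
  vanishing_cong U s t ->
  vanishing_cong V (trop_res nu hX h s) (trop_res nu hX h t).
Proof.
move=> st q Cq; apply: (st (hom_comp q (trop_res nu hX h))).
by rewrite -(@point_res U V h q).
Qed.

Lemma vanishing_cong_qc (U V : affine_open X) (h : V `<=` U) (f : trop_chart nu U) :
  localization_at f (trop_res nu hX h) -> forall s t, vanishing_cong V s t ->
  cong_gen (fun x y => exists a b, [/\ vanishing_cong U a b,
    x = trop_res nu hX h a & y = trop_res nu hX h b]) s t.
Proof.
move=> loc s t st E hE; set r := trop_res nu hX h in loc hE *.
have [a [b [n [sa tb]]]] := localization_frac2 loc s t.
(* The factor [f] makes both sides infinite at points where [f] is; every other point extends over
   the localization, where [s] and [t] agree. *)
have fab : vanishing_cong U (f * a) (f * b).
  move=> q Cq; rewrite !rmorphM.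
  have [->|/tmul_inv[y yf]] := pselect ((q f : T) = 0); first by rewrite !mul0r.
  rewrite mulrC in yf; have [q' q'E] := alghom_extend loc yf.
  congr (_ * _); rewrite -!q'E -sa -tb !rmorphM; congr (_ * _).
  by apply: st; rewrite (point_res q'E).
have [[u uf] _ _] := loc.
(* One power of [u] more than the common denominator has, to undo the extra factor [f]. *)
have inv x c : x * r f ^+ n = r c -> u ^+ n.+1 * r (f * c) = x.
  move=> xc; rewrite rmorphM -xc [r f * _]mulrCA -exprS.
  by rewrite mulrCA -exprMn uf expr1n mulr1.
rewrite -(inv s a sa) -(inv t b tb); apply: congM; first exact: cong_refl.
by apply: hE; exists (f * a), (f * b).
Qed.

Definition vanishing_subscheme : closed_subscheme (trop_univ nu hX) :=
  @ClosedSubscheme T (trop_univ nu hX) vanishing_cong vanishing_cong_res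
    vanishing_cong_qc.

Lemma strong_zariski_closedP : strong_zariski_closed C <->
  forall U : affine_open X,
    closed [set w : berkovich_affine nu U | C (point (val_point w))].
Proof.
split=> [[Z ->] U|hC].
  rewrite (_ : mkset _ = \bigcap_(p in [set p : _ * _ |
    Z U (tpi U p.1) (tpi U p.2)]) [set w | val_hom w p.1 = val_hom w p.2 :> T]).
    by apply: closed_bigI => p _; exact: closed_val_hom_eq.
  apply/seteqP; split=> w /=.
    by move/cs_pointsP => Zw [s t] /= /Zw; rewrite !val_pointE.
  move=> h; apply/cs_pointsP => s t.
  have [[g ->] [g' ->]] := (quot_piP s, quot_piP t).
  by rewrite !val_pointE => gg'; apply: (h (g, g')).
exists vanishing_subscheme; apply/seteqP; split=> p.
  have [[U q] ->] := cls_surj p.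
  by move=> Cq; apply/(cs_pointsP vanishing_subscheme) => s t; apply.
have [[U q] ->] := cls_surj p => /(cs_pointsP vanishing_subscheme) Zq.
have [w qE] := val_point_surj q.
apply: contrapT => nCq.
(* An equation that holds at all points of [C] in the chart and fails at [w]; it belongs to the
   vanishing congruence, which [q] respects. *)
have [|s [t [st hst]]] := @open_separated R k nu X U _ w (closed_openC (hC U)).
  by rewrite /= -qE.
apply: st; rewrite -!val_pointE -qE; apply: Zq => q' Cq'.
have [w' q'E] := val_point_surj q'.
by rewrite q'E !val_pointE; apply: hst; apply; rewrite /= -q'E.
Qed.

End CongruenceOfSet.

End Gluing.

Theorem theorem1 (R : realType) (k : fieldType) (nu : k -> trop R)
    (hnu : semivaluation nu) (X : scheme k) (hX : integral_scheme X) :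
  exists Phi : set_trop_univ nu X -> berkovich nu X,
  [/\ bijective Phi,
      (forall (U : affine_open X) (q : set_trop_local nu (@ev_ker k X U)),
        exists w : berkovich_affine nu U,
          (forall a : sec U,
             sval w a = sval q (@mon (mulmon (sec U)) (trop R) 1 a)) /\
          Phi (set_trop_class q) = berkovich_class w)
    & exists Psi : points (trop_univ nu hX) -> set_trop_univ nu X,
      [/\ bijective Psi,
          (forall (U : affine_open X)
             (q : alghom (trop_chart nu U) (alg_self (trop R))),
           exists q0 : set_trop_local nu (@ev_ker k X U),
             (forall g : tensor (mulmon (sec U)) (trop R),
                sval q0 g = q (quot_pi (bend nu (@ev_ker k X U)) g)) /\
             Psi (@point_class (trop R) (trop_univ nu hX) U q) =
               set_trop_class q0)
        & (forall C : set (points (trop_univ nu hX)),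
             strong_zariski_closed C <-> closed ((Phi \o Psi) @` C))]].
Proof.
have [Phi Phi_bij PhiE] : exists2 Phi : set_trop_univ nu X -> berkovich nu X,
    bijective Phi & forall U (q : set_trop_local nu (@ev_ker k X U)),
      Phi (set_trop_class q) = berkovich_class (solution_val hnu q).
  have [||||f fb fE] := @quo_bij _ _ (@set_trop_step R k nu X)
    (@berkovich_step R k nu X)
    (fun p => existT _ (tag p) (solution_val hnu (tagged p)))
    (fun p => existT _ (tag p) (val_solution (tagged p))).
  - by move=> [U q] /=; rewrite solution_valK.
  - by move=> [U w] /=; rewrite val_solutionK.
  - move=> [V q] [U q'] [/= h qq']; exists h => a /=.
    by rewrite qq' /hat_res tmap_mon.
  - move=> [V w] [U w'] [/= h ww']; exists h => g /=.
    exact: val_hom_res.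
  by exists f => // U q; exact: (fE (existT _ U q)).
have [Psi Psi_bij PsiE] : exists2 Psi : points (trop_univ nu hX) ->
    set_trop_univ nu X, bijective Psi &
    forall U (q : alghom (trop_chart nu U) (alg_self (trop R))),
      Psi (@point_class _ (trop_univ nu hX) U q) =
      set_trop_class (point_solution q).
  have [||||f fb fE] := @quo_bij _ _ (@point_step _ (trop_univ nu hX))
    (@set_trop_step R k nu X)
    (fun p => existT _ (tag p) (point_solution (tagged p)))
    (fun p => existT _ (tag p) (solution_point hX (tagged p))).
  - by move=> [U q] /=; rewrite point_solutionK.
  - by move=> [U q] /=; rewrite solution_pointK.
  - move=> [V q] [U q'] [/= h qq']; exists h => g.
    by rewrite !point_solutionE /= qq'; congr (q _); exact: trop_res_pi.
  - move=> [V q] [U q'] [/= h qq']; exists h => s /=.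
    have [g ->] := quot_piP s.
    apply: etrans (solution_pointE hX q' g) _; apply: etrans (qq' g) _.
    apply: etrans (esym (solution_pointE hX q _)) _.
    exact/(congr1 (solution_point hX q))/esym/trop_res_pi.
  by exists f => // U q; exact: (fE (existT _ U q)).
exists Phi; split=> // [U q|].
  by exists (solution_val hnu q).
exists Psi; split=> // [U q|C].
  by exists (point_solution q).
have classE U (w : berkovich_affine nu U) :
    berkovich_class w =
    (Phi \o Psi) (@point_class _ (trop_univ nu hX) U (val_point hX w)).
  by rewrite /= PsiE PhiE /val_point solution_pointK val_solutionK.
have inj : injective (Phi \o Psi) by apply: inj_comp; exact: bij_inj.
(* By injectivity, the image of [C] pulls back on each chart to exactly the semivaluations whose
   point lies in [C]. *)
have preE U : (@berkovich_class R k nu X U) @^-1` ((Phi \o Psi) @` C) =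
    [set w | C (@point_class _ (trop_univ nu hX) U (val_point hX w))].
  apply/seteqP; split=> w /=; first by rewrite classE => -[p Cp /inj <-].
  move=> Cw; rewrite classE.
  by exists (point_class (Y := trop_univ nu hX) (val_point hX w)).
(* [berkovich] carries the final topology, so openness is by definition a chartwise condition. *)
have opE (W : set (berkovich nu X)) :
    open W <-> forall U, open ((@berkovich_class R k nu X U) @^-1` W) by [].
rewrite (strong_zariski_closedP hnu) -openC opE.
by split=> h U; have := h U; rewrite -preE -openC.
Qed.
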